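(* In the dynamic pricing problem described in the context, with state space $X=[\underline M,\bar M]\times[0,\bar r]\times[\underline\tau,\bar\tau]$, action set $A=[0,\bar a]$ and discount factor $\beta\in(0,1)$, the following hold. (i) The Bellman operator $\mathcal T$ is a contraction with modulus $\beta$. It has a unique bounded continuous value function $V$ (fixed point $V=\mathcal TV$) and a nonempty upper-hemicontinuous optimal stationary-policy correspondence $(M,r,\tau)\mapsto\arg\max_{a\in A}Q(a;M,r,\tau)$, where $$Q(a;M,r,\tau)=\pi(M,a,r,\tau)+\beta\,C_V(M,a,r,\tau).$$ (ii) At any state where $\Delta_V\ge 0$ and the expected relationship derivatives $\mathbb E_\eta[V_r^+]$ and $V_r^0$ are nonpositive, the marginal continuation value of extraction, $$\beta D_a\,\Delta_V+\beta\gamma\big\{D\,\mathbb E_\eta[V_r^+]+(1-D)V_r^0\big\},$$ is nonpositive. (iii) At such a state, if the exact state objective $a\mapsto Q(a;M,r,\tau)$ is strictly concave in $a$, then the dynamic optimum (the maximizer of $Q(\cdot;M,r,\tau)$ over $A$) is no more extractive than the exact myopic optimum (the maximizer of $\pi(M,\cdot,r,\tau)$ over $A$); that is, the dynamically optimal $a$ is weakly smaller than the myopically optimal $a$. (iv) The restrained action $a^*=0$ is optimal at a state whenever the right derivative at $a=0$ of the objective $Q(\cdot;M,r,\tau)$ is nonpositive and the objective is concave on $A$.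
   Context: Parameters: $\kappa>0$, $\tau_z>0$, $\ell>0$, $\underline u>0$, $\chi$ real, $0\le\rho<1$, $\gamma>0$, $\beta\in(0,1)$; $[\underline M,\bar M]$, $[0,\bar r]$, $[\underline\tau,\bar\tau]$ (with $\underline\tau>0$) and $A=[0,\bar a]$ are compact intervals. $\Phi,\phi$ are the standard normal cdf and density. The state is $(M,r,\tau)$: public margin, trust distance, public posterior precision. The action $a\in A$ is the seller's extraction. Definitions. $h(a,r)=\ell-\underline u-a-\chi r$; $\omega(\tau)=\sqrt{2\kappa}/(\tau+\kappa)$; $k=h(a,r)/\omega(\tau)$. The trade probability is $D=D(a,r,\tau)=\Phi(k)$, with $D_a=\partial D/\partial a=-\phi(k)/\omega(\tau)$. The exact expected current profit is $\pi(M,a,r,\tau)=(M+a)\Phi(k)-\tfrac{\omega(\tau)}{2}\phi(k)$. Transitions. $r'=\min\{\bar r,\rho r+\gamma a\}$ whether or not trade occurs. If trade occurs, $\tau^+=\min\{\bar\tau,\tau+\tau_z\}$ and $M^+=\Pi(M+\eta)$, where $\Pi$ is projection onto $[\underline M,\bar M]$ and $\eta\sim N\big(0,\tau_z/[\tau(\tau+\tau_z)]\big)$. If no trade occurs, $M$ and $\tau$ are unchanged. For $W\in C(X)$, the bounded continuous functions on $X$ with the sup norm, $$C_W(M,a,r,\tau)=D(a,r,\tau)\,\mathbb E_\eta W(M^+,r',\tau^+)+[1-D(a,r,\tau)]\,W(M,r',\tau),$$ $$(\mathcal TW)(M,r,\tau)=\max_{a\in A}\{\pi(M,a,r,\tau)+\beta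 C_W(M,a,r,\tau)\}.$$ The expected value of one additional traded outcome at the next trust state is $\Delta_V=\Delta_V(M,r',\tau)=\mathbb E_\eta[V(M^+,r',\tau^+)]-V(M,r',\tau)$. $V_r^+$ and $V_r^0$ denote the derivative of $V$ in the trust state after trade and after no trade, i.e. $\partial_rV(M^+,r',\tau^+)$ and $\partial_rV(M,r',\tau)$. Derivatives involving $V$ are understood at interior differentiability points (away from the caps), where the derivative of the Bellman objective is $$Q_a=D+(M+a)D_a-\tfrac12k\phi(k)+\beta D_a\Delta_V+\beta\gamma\{D\,\mathbb E_\eta[V_r^+]+(1-D)V_r^0\};$$ the first three terms are the exact myopic derivative $\partial\pi/\partial a$ and the last two are the marginal continuation value of extraction. *)

(* Defs.v *)
From HB Require Import structures.
From mathcomp Require Import all_boot all_order all_algebra.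
From mathcomp Require Import all_classical all_reals all_analysis.
Import Order.TTheory GRing.Theory Num.Theory.
Import numFieldNormedType.Exports.

Set Implicit Arguments.
Unset Strict Implicit.
Unset Printing Implicit Defensive.

Local Open Scope classical_set_scope.
Local Open Scope ring_scope.

Section Generic.
Context {R : realType}.

(* Neighbourhoods are taken in the subspace D. *)
Definition upper_hemicontinuous {S T : topologicalType} (D : set S)
    (G : S -> set T) :=
  forall x, D x -> forall U : set T, open U -> G x `<=` U ->
    \forall y \near within D (nbhs x), G y `<=` U.

Definition argmax_on {T : Type} (A : set T) (f : T -> R) : set T :=
  [set a | A a /\ forall b, A b -> f b <= f a].

Definition strictly_concave_on (A : set R) (f : R -> R) :=
  forall x y t, A x -> A y -> x != y -> 0 < t < 1 ->
    t * f x + (1 - t) * f y < f (t * x + (1 - t) * y).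

Definition concave_on (A : set R) (f : R -> R) :=
  convex_function (A : set R^o) (fun x => - f x).

Definition has_right_derivative (f : R -> R) (x l : R) :=
  h^-1 * (f (x + h) - f x) @[h --> 0^'+] --> l.

Definition npdf (x : R) : R := normal_pdf 0 1 x.
Definition ncdf (x : R) : R := fine (normal_prob 0 1 `]-oo, x]).

End Generic.

(* Degenerate (one-point) intervals are allowed. *)
Record primitives (R : realType) := Primitives {
  kappa : R; tauz : R; ell : R; ulow : R; chi : R; rho : R; gamma : R;
  beta : R;
  Mlo : R; Mhi : R; rbar : R; taulo : R; tauhi : R; abar : R;
  kappa_gt0 : 0 < kappa;
  tauz_gt0 : 0 < tauz;
  ell_gt0 : 0 < ell;
  ulow_gt0 : 0 < ulow;
  rho_ge0 : 0 <= rho;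
  rho_lt1 : rho < 1;
  gamma_gt0 : 0 < gamma;
  beta_gt0 : 0 < beta;
  beta_lt1 : beta < 1;
  Mlo_le_Mhi : Mlo <= Mhi;
  rbar_ge0 : 0 <= rbar;
  taulo_gt0 : 0 < taulo;
  taulo_le_tauhi : taulo <= tauhi;
  abar_ge0 : 0 <= abar
}.

Section Model.
Context {R : realType} (p : primitives R).

(* A state is a triple (M, r, tau). *)
Definition state : Type := (R * R * R)%type.

Definition states : set state :=
  [set s | [/\ Mlo p <= s.1.1 <= Mhi p, 0 <= s.1.2 <= rbar p
             & taulo p <= s.2 <= tauhi p]].

Definition actions : set R := [set a | 0 <= a <= abar p].

Definition hfun (a r : R) : R := ell p - ulow p - a - chi p * r.
Definition omega (tau : R) : R := Num.sqrt (2 * kappa p) / (tau + kappa p).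
Definition kfun (a r tau : R) : R := hfun a r / omega tau.

Definition trade_prob (a r tau : R) : R := ncdf (kfun a r tau).

Definition trade_prob_a (a r tau : R) : R :=
  derive1 (fun b => trade_prob b r tau) a.

Definition profit (M a r tau : R) : R :=
  (M + a) * ncdf (kfun a r tau) - omega tau / 2 * npdf (kfun a r tau).

Definition next_r (r a : R) : R := Num.min (rbar p) (rho p * r + gamma p * a).
Definition next_tau (tau : R) : R := Num.min (tauhi p) (tau + tauz p).
Definition next_M (M eta : R) : R :=
  Num.max (Mlo p) (Num.min (Mhi p) (M + eta)).

(* The second argument of [normal_prob] is the standard deviation. *)
Definition eta_sd (tau : R) : R := Num.sqrt (tauz p / (tau * (tau + tauz p))).

Definition Eeta (tau : R) (f : R -> R) : R := fine ('E_(normal_prob 0 (eta_sd tau))[f])%E.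

(* C(X), with X the set states: functions on X are represented by total functions on state, and are
   identified when they agree on X; their values off X are never used. *)
Definition CX : set (state -> R) :=
  [set W | {within states, continuous W} /\ [bounded W s | s in states]].

Definition supnorm (W : state -> R) : R := sup [set `|W s| | s in states].

Definition continuation (W : state -> R) (M a r tau : R) : R :=
  trade_prob a r tau
    * Eeta tau (fun eta => W (next_M M eta, next_r r a, next_tau tau))
  + (1 - trade_prob a r tau) * W (M, next_r r a, tau).

Definition objective (W : state -> R) (s : state) (a : R) : R :=
  let: (M, r, tau) := s in
  profit M a r tau + beta p * continuation W M a r tau.

(* For W in CX and s in states the supremum is attained. *)
Definition bellman (W : state -> R) (s : state) : R :=
  sup [set objective W s a | a in actions].

Definition value_function (V : state -> R) :=
  CX V /\ {in states, V =1 bellman V}.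

Definition policy (V : state -> R) (s : state) : set R :=
  argmax_on actions (objective V s).

Definition myopic_policy (s : state) : set R :=
  let: (M, r, tau) := s in argmax_on actions (fun a => profit M a r tau).

Definition DeltaV (V : state -> R) (M r' tau : R) : R :=
  Eeta tau (fun eta => V (next_M M eta, r', next_tau tau)) - V (M, r', tau).

Definition dr (V : state -> R) (M r tau : R) : R :=
  derive1 (fun x => V (M, x, tau)) r.

Definition EVr_trade (V : state -> R) (M r' tau : R) : R :=
  Eeta tau (fun eta => dr V (next_M M eta) r' (next_tau tau)).

Definition Vr_notrade (V : state -> R) (M r' tau : R) : R := dr V M r' tau.

(* Interior differentiability point: the next trust state is uncapped and
   interior, and the partial derivatives of V in the trust state that enter the
   derivative of the objective exist. *)
Definition differentiability_point (V : state -> R) (s : state) (a : R) :=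
  let: (M, r, tau) := s in
  let r' := next_r r a in
  [/\ 0 < rho p * r + gamma p * a < rbar p,
      derivable (fun x => V (M, x, tau)) r' 1 &
      {ae normal_prob 0 (eta_sd tau), forall eta,
        derivable (fun x => V (next_M M eta, x, next_tau tau)) r' 1}].

(* The sign conditions involve the next trust state, hence the action a. *)
Definition restraint_condition (V : state -> R) (s : state) (a : R) :=
  let: (M, r, tau) := s in
  let r' := next_r r a in
  [/\ differentiability_point V s a,
      0 <= DeltaV V M r' tau,
      EVr_trade V M r' tau <= 0 &
      Vr_notrade V M r' tau <= 0].

Definition marginal_continuation (V : state -> R) (s : state) (a : R) : R :=
  let: (M, r, tau) := s in
  let r' := next_r r a in
  beta p * trade_prob_a a r tau * DeltaV V M r' tau
  + beta p * gamma p
    * (trade_prob a r tau * EVr_trade V M r' tau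
       + (1 - trade_prob a r tau) * Vr_notrade V M r' tau).

End Model.

(* Main.v *)
(* On the box of states the one-period profit is bounded and, like the trade probability,
   Lipschitz in the trust distance, and the expectation over the Gaussian shock is continuous
   in the state by dominated convergence applied to the densities. By Berge's maximum theorem
   the Bellman operator then maps C(X) to itself, and discounting makes it a contraction,
   which gives (i). Since trust is carried over with factor rho and discounted by beta, with beta rho < 1, the operator also
   preserves a class of functions that are Lipschitz in the trust distance, so the value
   function is one of them; this bound dominates its difference quotients and allows
   differentiation of the objective under the expectation.

   For (iii), suppose the dynamic optimum exceeds the myopic one. If the sign conditions hold
   at the myopic optimum, the objective has a nonpositive derivative there, which contradicts
   strict concavity. If they hold at the dynamic optimum, the derivative of profit is
   nonnegative there; but profit is single-peaked, since by Mills' ratio its derivative divided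
   by the normal density is decreasing in the action, so the dynamic optimum would have a
   strictly larger profit than the myopic one. *)

Require Import Defs.
From HB Require Import structures.
From mathcomp Require Import all_boot all_order all_algebra.
From mathcomp Require Import all_classical all_reals all_analysis.
From mathcomp Require Import measurable_realfun ring lra.
Import Order.TTheory GRing.Theory Num.Theory.
Import numFieldNormedType.Exports.

Set Implicit Arguments.
Unset Strict Implicit.
Unset Printing Implicit Defensive.

Local Open Scope classical_set_scope.
Local Open Scope ring_scope.

(** * The standard normal distribution *)

Section StandardNormal.
Context {R : realType}.
Local Notation mu := (@lebesgue_measure R).

Lemma npdfE (x : R) : npdf x = normal_peak 1 * expR (- x ^+ 2 / 2).
Proof.
rewrite /npdf normal_pdfE ?oner_neq0// /normal_fun subr0.
by rewrite expr1n.
Qed.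

Lemma npdf_gt0 (x : R) : 0 < npdf x.
Proof.
by rewrite npdfE mulr_gt0 ?expR_gt0// normal_peak_gt0// oner_neq0.
Qed.

Lemma continuous_npdf : continuous (@npdf R).
Proof. exact: continuous_normal_pdf (oner_neq0 _). Qed.

Lemma is_derive_npdf (x : R) : is_derive x 1 (@npdf R) (- (x * npdf x)).
Proof.
rewrite (_ : @npdf R = fun x => normal_peak 1 * expR (- x ^+ 2 / 2)); last first.
  by apply/funext => y; rewrite npdfE.
apply: is_derive_eq => /=.
by rewrite /GRing.scale/=; field.
Qed.

(** [ncdf] unfolds to the integral of [npdf] from minus infinity, so this is the fundamental theorem
    of calculus; [x + 1] is just some endpoint beyond [x]. *)
Lemma is_derive_ncdf (x : R) : is_derive x 1 (@ncdf R) (npdf x).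
Proof.
have h := @continuous_FTC1 R (@npdf R) -oo%O x (x + 1).
have [||||dF FE] := h.
- by rewrite ltrDl.
- apply: (integrableS _ _ (@subsetT _ _)) => //=.
  exact: integrable_normal_pdf.
- by rewrite ltNyr.
- exact: continuous_npdf.
by split; [exact: dF|rewrite -derive1E].
Qed.

Lemma continuous_ncdf : continuous (@ncdf R).
Proof.
move=> x; apply: differentiable_continuous; apply/derivable1_diffP.
by have [] := is_derive_ncdf x.
Qed.

Lemma ncdf_ge0 (x : R) : 0 <= ncdf x.
Proof. by rewrite /ncdf fine_ge0. Qed.

Lemma ncdf_le1 (x : R) : ncdf x <= 1.
Proof.
rewrite -lee_fin /ncdf fineK ?fin_num_measure//.
exact: probability_le1.
Qed.

Lemma ncdf_cvgNy0 : @ncdf R x @[x --> -oo] --> 0.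
Proof.
(* [ncdf] is the cdf of the identity random variable under the standard normal law. *)
pose X : {mfun measurableTypeR R >-> R} := HB.pack (@idfun R)
  (@isMeasurableFun.Build _ _ (measurableTypeR R) R idfun
    (@measurable_id _ _ setT)).
have := @cvg_cdfNy0 _ _ _ (normal_prob 0 1 : probability (measurableTypeR R) R) X.
move=> /fine_cvgP[_]; apply: cvg_trans; apply: near_eq_cvg.
near=> y; rewrite /= /cdf /distribution/= /pushforward/= /ncdf.
by congr fine.
Unshelve. all: by end_near. Qed.

(* Mills' ratio bound: [ncdf + npdf / id] is decreasing on the negative half-line and
   dominated by [ncdf], which vanishes at [-oo]. *)
Lemma mills_bound (x : R) : 0 <= npdf x + x * ncdf x.
Proof.
have [x0|x0] := leP 0 x.
  by rewrite addr_ge0 ?mulr_ge0 ?ncdf_ge0// ltW// npdf_gt0.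
pose F (y : R) := ncdf y + npdf y / y.
have dF (y : R) : y < 0 -> is_derive y 1 F (- (npdf y / y ^+ 2)).
  move=> y0; have y_neq0 : y != 0 by rewrite lt_eqF.
  have dn := is_derive_ncdf y; have dp := is_derive_npdf y.
  have dv : is_derive y 1 (fun z : R => z^-1) (- y ^- 2).
    apply: (is_derive_eq (is_deriveV (f := id) y_neq0 (is_derive_id y 1))).
    by rewrite /GRing.scale/= mulr1.
  apply: (is_derive_eq (is_deriveD dn (is_deriveM dp dv))).
  by rewrite /GRing.scale/=; field.
have Fx (y : R) : y < x -> F x <= ncdf y.
  move=> yx; have y0 := lt_trans yx x0.
  apply: (@le_trans _ _ (F y)); last first.
    by rewrite gerDl nmulr_lle0 ?invr_lt0// ltW// npdf_gt0.
  have neg z : z \in `[y, x] -> z < 0.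
    by rewrite in_itv/= => /andP[_ zx]; exact: le_lt_trans x0.
  have negoo z : z \in `]y, x[ -> z < 0.
    by move=> zyx; apply: neg; apply: subset_itv_oo_cc zyx.
  apply: (@ler0_derive1_le_cc _ F y x); rewrite ?in_itv/= ?lexx ?ltW//.
  - by move=> z /negoo /dF[].
  - move=> z /negoo z0; rewrite derive1E; have [_ ->] := dF _ z0.
    by rewrite oppr_le0 divr_ge0 ?sqr_ge0// ltW// npdf_gt0.
  - apply: derivable_within_continuous => z /neg /dF[].
    done.
have : F x <= 0.
  apply: (cvgr_to_ge ncdf_cvgNy0); near=> y; apply: Fx; near: y.
  by apply: nbhs_ninfty_lt; rewrite num_real.
(* Multiplying [F x <= 0] by the negative number [x] gives the claim. *)
rewrite /F -(ler_nM2l x0) mulr0 mulrDr mulrCA divff ?lt_eqF// mulr1.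
by rewrite addrC.
Unshelve. all: by end_near. Qed.

Lemma lipschitz_of_derive (f df : R -> R) (K : R) :
  (forall x : R, is_derive x 1 f (df x)) -> (forall x, `|df x| <= K) ->
  forall x y, `|f x - f y| <= K * `|x - y|.
Proof.
move=> fd dK.
have wlg x y : x <= y -> `|f x - f y| <= K * `|x - y|.
  move=> xy; have cf : {within `[x, y], continuous f}.
    by apply: derivable_within_continuous => z _; have [] := fd z.
  have [c _ fxy] := @MVT_segment _ f df _ _ xy (fun z _ => fd z) cf.
  by rewrite distrC fxy normrM (distrC x) ler_wpM2r.
move=> x y; have [|/ltW] := leP x y; first exact: wlg.
by rewrite distrC (distrC x); exact: wlg.
Qed.

Lemma npdf_le (x : R) : npdf x <= normal_peak 1.
Proof. exact: normal_pdf_ub (oner_neq0 _). Qed.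

Lemma ncdf_lipschitz (x y : R) : `|ncdf x - ncdf y| <= normal_peak 1 * `|x - y|.
Proof.
apply: lipschitz_of_derive => [z|z]; first exact: is_derive_ncdf.
by rewrite gtr0_norm ?npdf_gt0// npdf_le.
Qed.

Lemma npdf_lipschitz (x y : R) : `|npdf x - npdf y| <= normal_peak 1 * `|x - y|.
Proof.
apply: lipschitz_of_derive => [z|z]; first exact: is_derive_npdf.
rewrite normrN normrM (gtr0_norm (npdf_gt0 _)) npdfE mulrCA.
rewrite ler_piMr ?normal_peak_ge0//.
rewrite mulNr expRN -ler_pdivlMr ?invr_gt0 ?expR_gt0// mul1r invrK.
(* It remains to bound [|z|] by [exp(z^2 / 2)], which is at least [1 + z^2 / 2]. *)
apply: le_trans (expR_ge1Dx _).
rewrite -[z ^+ 2]real_normK ?num_real//.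
by move: `|z| => t; nra.
Qed.

End StandardNormal.

(** * Expectations of bounded functions *)

Section NullSet.
Context d (T : measurableType d) (R : realType).
Variable mu : {measure set T -> \bar R}.
Local Open Scope ereal_scope.
Import HBNNSimple.

(** The form to which the integral of a nonnegative function unfolds, kept explicit because [f] may
    be nonmeasurable. *)
Let nnint (f : T -> \bar R) := ereal_sup [set sintegral mu h |
  h in [set h : {nnsfun T >-> R} | forall x, (h x)%:E <= f x]].

Let nnint_null (N : set T) (f : T -> \bar R) : measurable N -> mu N = 0 ->
  (forall x, 0 <= f x) -> nnint f = nnint (f \_ (~` N)).
Proof.
move=> mN N0 f0; apply/eqP; rewrite eq_le; apply/andP; split; last first.
  apply: le_ereal_sup => _ [h /= hf <-]; exists h => // x.
  apply: le_trans (hf x) _; rewrite patchE; case: ifPn => // _.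
apply: ge_ereal_sup => _ [h /= hf <-].
have mCN := measurableC mN.
(* [proj_nnsfun h mCN] is [h] set to zero on [N]: it lies below the cut-off [f] and has the same
   integral because [N] is null. *)
rewrite (_ : sintegral mu h = sintegral mu (proj_nnsfun h mCN)).
  apply: ereal_sup_ubound; exists (proj_nnsfun h mCN) => //= x.
  rewrite patchE /= mindicE.
  by case: ifPn => _; rewrite ?mulr1 ?mulr0.
have sE (g : {nnsfun T >-> R}) : sintegral mu g = \int[mu]_x (g x)%:E.
  by rewrite integral_nnsfun// patch_setT.
rewrite !sE.
rewrite (ge0_negligible_integral mN measurableT) ?setTD//; last first.
- by move=> x _; rewrite lee_fin.
- exact/measurable_EFinP.
rewrite integral_mkcond; apply: eq_integral => x _.
by rewrite patchE /= mindicE; case: ifPn => _; rewrite ?mulr1 ?mulr0.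
Qed.

(* Cutting off on [N] does not change the integral of a simple function below [f], so this
   also holds for nonmeasurable [f]. *)
Lemma integral_restrict_null (N : set T) (f : T -> \bar R) :
  measurable N -> mu N = 0 -> \int[mu]_x f x = \int[mu]_x (f \_ (~` N)) x.
Proof.
move=> mN N0; rewrite /integral !patch_setT funepos_restrict funeneg_restrict.
congr (_ - _); rewrite -[LHS]/(nnint _) -[RHS]/(nnint _).
  by rewrite (nnint_null mN N0).
by rewrite (nnint_null mN N0).
Qed.

End NullSet.

Section Expectation.
Context {R : realType} (P : probability (measurableTypeR R) R).
Local Notation mE f := (fine ('E_P[f])%E).
Implicit Types f g : R -> R.

Lemma fine_expectationE f : mE f = \int[P]_x f x.
Proof. by rewrite unlock. Qed.

Lemma bounded_integrable f (B : R) : measurable_fun setT f ->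
  (forall x, `|f x| <= B) -> P.-integrable setT (EFin \o f).
Proof.
move=> mf fB; apply: measurable_bounded_integrable => //.
  by rewrite -ge0_fin_numE// fin_num_measure.
exists B; split; rewrite ?num_real// => M BM x _.
exact: le_trans (fB x) (ltW BM).
Qed.

Lemma fine_expectation_cst (c : R) : mE (cst c) = c.
Proof. by rewrite expectation_cst. Qed.

Lemma fine_expectationB f g (B : R) : measurable_fun setT f -> measurable_fun setT g ->
  (forall x, `|f x| <= B) -> (forall x, `|g x| <= B) ->
  mE (f \- g) = mE f - mE g.
Proof.
move=> mf mg fB gB; rewrite !fine_expectationE RintegralB//.
  exact: bounded_integrable fB.
exact: bounded_integrable gB.
Qed.

Lemma fine_expectationZ (c : R) f (B : R) :
  measurable_fun setT f -> (forall x, `|f x| <= B) ->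
  mE (fun x => (c * f x)%R) = c * mE f.
Proof.
move=> mf fB; rewrite !fine_expectationE RintegralZl//.
exact: bounded_integrable fB.
Qed.

Lemma fine_expectation_norm_le f (c : R) : measurable_fun setT f ->
  (forall x, `|f x| <= c) -> `|mE f| <= c.
Proof.
move=> mf fc; have fi := bounded_integrable mf fc.
have ci (k : R) : P.-integrable setT (EFin \o cst k).
  by apply: (@bounded_integrable _ `|k|) => //=.
have ce (k : R) : \int[P]_x k = k by rewrite -fine_expectationE fine_expectation_cst.
rewrite fine_expectationE ler_norml -{2}(ce c) -(ce (- c)).
by apply/andP; split; apply: le_Rintegral => //=; try exact: ci;
  move=> x _; have := fc x; rewrite ler_norml => /andP[].
Qed.

Lemma fine_expectation_near f g (B c : R) :
  measurable_fun setT f -> measurable_fun setT g ->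
  (forall x, `|f x| <= B) -> (forall x, `|g x| <= B) ->
  (forall x, `|f x - g x| <= c) -> `|mE f - mE g| <= c.
Proof.
move=> mf mg fB gB fg; rewrite -(fine_expectationB mf mg fB gB).
apply: fine_expectation_norm_le => //; exact: measurable_funB.
Qed.

(* [f] will be a partial derivative, which takes junk values where it does not exist, so it
   may be nonmeasurable on the null set where the sequence fails to converge. *)
Lemma fine_expectation_cvg (f_ : (R -> R)^nat) f (L : R) :
  (forall n, measurable_fun setT (f_ n)) -> (forall n x, `|f_ n x| <= L) ->
  {ae P, forall x, f_ n x @[n --> \oo] --> f x} ->
  mE (f_ n) @[n --> \oo] --> mE f.
Proof.
move=> mf fL [N [mN N0 fN]].
have off x : (~` N) x -> f_ n x @[n --> \oo] --> f x.
  by move=> Nx; apply: contrapT => nf; apply: Nx; exact: fN.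
(* After cutting off on the null set [N] convergence holds everywhere, so the limit [g] is
   measurable. *)
pose g_ n : R -> \bar R := (EFin \o f_ n) \_ (~` N).
pose g : R -> \bar R := (EFin \o f) \_ (~` N).
have mg n : measurable_fun setT (g_ n).
  apply/(measurable_restrictT _ _).1; first exact: measurableC.
  by apply: measurable_funTS; exact/measurable_EFinP.
have gcvg x : setT x -> g_ n x @[n --> \oo] --> g x.
  move=> _; rewrite /g_ /g patchE; under eq_fun do rewrite patchE.
  case: ifPn => [/set_mem/off xN|_]; last exact: cvg_cst.
  by apply: cvg_EFin => //; exact: nearW.
have Li : P.-integrable setT (EFin \o cst L).
  by apply: (@bounded_integrable _ `|L|) => //=.
have L0 : 0 <= L by exact: le_trans (fL 0%N 0).
have gL n x : (`|g_ n x| <= (EFin \o cst L) x)%E.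
  rewrite /g_ patchE; case: ifPn => _ /=; first by rewrite lee_fin.
  by rewrite normr0 lee_fin.
have mgl : measurable_fun setT g by exact: emeasurable_fun_cvg gcvg.
have acvg : {ae P, forall x, setT x -> g_ n x @[n --> \oo] --> g x}.
  by apply: aeW => x; exact: gcvg.
have aL : {ae P, forall x n, setT x -> (`|g_ n x| <= (EFin \o cst L) x)%E}.
  by apply: aeW => x n _; exact: gL.
have [gi _ gg] := @dominated_convergence _ (measurableTypeR R) R P _ measurableT
  g_ g (EFin \o cst L) mg mgl acvg Li aL.
have gf : (\int[P]_x g x = (mE f)%:E)%E.
  have gfE : (\int[P]_x g x = \int[P]_x (f x)%:E)%E.
    by rewrite [RHS](integral_restrict_null _ mN N0).
  by rewrite unlock -gfE fineK//; exact: (integrable_fin_num measurableT gi).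
move: gg; rewrite gf => /fine_cvg; apply: cvg_trans.
apply: near_eq_cvg; apply: nearW => n /=.
by rewrite unlock -(integral_restrict_null _ mN N0).
Qed.

End Expectation.

(** * Gaussian expectations through the density, with varying standard deviation *)

Section NormalDensity.
Context {R : realType}.
Local Notation mu := (@lebesgue_measure R).
Local Notation mE P f := (fine ('E_P[f])%E).

(** The Radon-Nikodym derivative of the law agrees almost everywhere with [normal_pdf], since both
    integrate to the law of every measurable set. *)
Lemma integral_normal_prob (m s : R) U (f : measurableTypeR R -> \bar R) :
  measurable U -> measurable_fun U f ->
  (\int[normal_prob m s]_(x in U) `|f x| < +oo)%E ->
  (\int[normal_prob m s]_(x in U) f x =
   \int[mu]_(x in U) (f x * (normal_pdf m s x)%:E))%E.
Proof.
move=> mU mf finf; have dom := normal_prob_dominates m s.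
rewrite -(Radon_Nikodym_change_of_variables dom)//=; last exact/integrableP.
apply: ae_eq_integral => //.
- apply: emeasurable_funM => //; apply: (measurable_int mu).
  apply: (integrableS _ _ (@subsetT _ _)) => //=.
  exact: Radon_Nikodym_integrable.
- apply: emeasurable_funM => //=; apply/measurableT_comp => //=.
  by apply/measurable_funTS; exact: measurable_normal_pdf.
apply: ae_eqe_mul2l => /=; rewrite Radon_NikodymE//=.
case: cid => /= h [h1 h2 h3]; apply: integral_ae_eq => //=.
- exact: integrableS h2.
- by apply/measurable_funTS/measurableT_comp => //; exact: measurable_normal_pdf.
- by move=> E EU mE; rewrite -h3.
Qed.

(** The peak is largest at the smallest standard deviation and the exponential factor at the
    largest. One integrable function thus dominates all densities with [s] in [[lo, hi]]. *)
Lemma normal_pdf_dominated (lo hi s x : R) : 0 < lo -> lo <= s <= hi ->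
  normal_pdf 0 s x <= normal_peak lo / normal_peak hi * normal_pdf 0 hi x.
Proof.
move=> lo0 /andP[los shi]; have s0 := lt_le_trans lo0 los.
have hi0 := lt_le_trans s0 shi.
rewrite !normal_pdfE ?gt_eqF// mulrA divfK ?gt_eqF ?normal_peak_gt0 ?gt_eqF//.
apply: ler_pM; rewrite ?normal_peak_ge0 ?normal_fun_ge0//.
  rewrite /normal_peak lef_pV2 ?posrE ?sqrtr_gt0 ?pmulrn_lgt0 ?mulr_gt0 ?exprn_gt0 ?pi_gt0//.
  by rewrite ler_wsqrtr// lerMn2r/= ler_wpM2r ?pi_ge0// lerXn2r// nnegrE ltW.
rewrite /normal_fun ler_expR !mulNr lerN2 ler_wpM2l ?sqr_ge0//.
rewrite lef_pV2 ?posrE ?pmulrn_lgt0 ?exprn_gt0//.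
by rewrite lerMn2r/= lerXn2r// nnegrE ltW.
Qed.

Lemma cvg_normal_pdf (s_ : R^nat) (s x : R) : 0 < s -> s_ n @[n --> \oo] --> s ->
  (forall n, 0 < s_ n) ->
  normal_pdf 0 (s_ n) x @[n --> \oo] --> normal_pdf 0 s x.
Proof.
move=> s0 ss sn0; under eq_fun do rewrite normal_pdfE ?gt_eqF//.
rewrite normal_pdfE ?gt_eqF//.
have s2 : (s_ n ^+ 2) @[n --> \oo] --> s ^+ 2.
  by rewrite expr2; under eq_fun do rewrite expr2; exact: cvgM.
apply: cvgM.
  rewrite /normal_peak; apply: cvgV.
    by rewrite gt_eqF// sqrtr_gt0 pmulrn_lgt0// mulr_gt0 ?exprn_gt0 ?pi_gt0.
  apply: (@continuous_cvg _ _ _ _ _ _ (@Num.sqrt R)); first exact: sqrt_continuous.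
  by apply: cvgMn; apply: cvgMl.
rewrite /normal_fun; apply: continuous_cvg; first exact: continuous_expR.
apply: cvgMr; apply: cvgV; first by rewrite gt_eqF// pmulrn_lgt0// exprn_gt0.
exact: cvgMn.
Qed.

(** The measure itself moves with [n]. Writing expectations against Lebesgue measure puts this
    motion into the densities, where dominated convergence applies. *)
Lemma normal_expectation_cvg (s_ : R^nat) (s lo hi B : R)
    (f_ : (R -> R)^nat) (f : R -> R) :
  0 < lo -> (forall n, lo <= s_ n <= hi) -> s_ n @[n --> \oo] --> s ->
  (forall n, measurable_fun setT (f_ n)) -> measurable_fun setT f ->
  (forall n x, `|f_ n x| <= B) ->
  (forall x, f_ n x @[n --> \oo] --> f x) ->
  mE (normal_prob 0 (s_ n)) (f_ n) @[n --> \oo] --> mE (normal_prob 0 s) f.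
Proof.
move=> lo0 slohi ss mf_ mf fB ff.
have sn0 n : 0 < s_ n by have /andP[+ _] := slohi n; exact: lt_le_trans.
have slo : lo <= s <= hi.
  apply/andP; split; [apply: (cvgr_to_ge ss)|apply: (cvgr_to_le ss)];
    by apply: nearW => n; have /andP[] := slohi n.
have s0 : 0 < s by have /andP[+ _] := slo; exact: lt_le_trans.
have hi0 : 0 < hi by have /andP[_] := slo; exact: lt_le_trans.
have B0 : 0 <= B := le_trans (normr_ge0 _) (fB 0%N 0).
have fB' x : `|f x| <= B.
  by apply: (cvgr_to_le (cvg_norm (ff x))); apply: nearW => n.
have EE (t : R) (g : R -> R) : measurable_fun setT g -> (forall x, `|g x| <= B) ->
    ('E_(normal_prob 0 t)[g] = \int[mu]_x (g x * normal_pdf 0 t x)%:E)%E.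
  move=> mg gB; rewrite unlock integral_normal_prob//.
    exact/measurable_EFinP.
  by have /integrableP[_] := bounded_integrable (normal_prob 0 t) mg gB.
have mpdf (t : R) (g : R -> R) : measurable_fun setT g ->
    measurable_fun setT (fun x => (g x * normal_pdf 0 t x)%:E).
  move=> mg; apply/measurable_EFinP; apply: measurable_funM => //.
  exact: measurable_normal_pdf.
pose K := B * (normal_peak lo / normal_peak hi).
have K0 : 0 <= K by rewrite /K !mulr_ge0 ?invr_ge0 ?normal_peak_ge0.
have Ki : mu.-integrable setT (fun x => (K * normal_pdf 0 hi x)%:E).
  under eq_fun do rewrite EFinM.
  apply: integrableZl => //; exact: integrable_normal_pdf.
have [||_ _ +] := @dominated_convergence _ _ R mu _ measurableT
  (fun n x => (f_ n x * normal_pdf 0 (s_ n) x)%:E)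
  (fun x => (f x * normal_pdf 0 s x)%:E)
  (fun x => (K * normal_pdf 0 hi x)%:E)
  (fun n => mpdf _ _ (mf_ n)) (mpdf _ _ mf) _ Ki.
- apply: aeW => x _; apply: cvg_EFin; first exact: nearW.
  by apply: cvgM => //; exact: cvg_normal_pdf.
- apply: aeW => x n _; rewrite lee_fin normrM (ger0_norm (normal_pdf_ge0 _ _ _)).
  rewrite /K -mulrA; apply: ler_pM => //; first exact: normal_pdf_ge0.
  exact: normal_pdf_dominated.
rewrite -(EE _ _ mf fB') => h; apply: fine_cvg; rewrite fineK; last first.
  rewrite unlock; apply: integrable_fin_num => //.
  exact: (bounded_integrable (normal_prob 0 s) mf fB').
move: h; apply: cvg_trans; apply: near_eq_cvg; apply: nearW => n /=.
by rewrite EE.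
Qed.

End NormalDensity.

(** * Parametric maximisation and contractions *)

Section Optimisation.
Context {R : realType}.

(** A failure of continuity yields points within [1/(n+1)] of [x] whose images stay away from [f x].
    Sequences are the form in which dominated convergence delivers limits. *)
Lemma seq_continuous_at (S T : pseudoMetricType R) (f : S -> T) (x : S) :
  (forall u : nat -> S, u n @[n --> \oo] --> x -> f (u n) @[n --> \oo] --> f x) ->
  f y @[y --> x] --> f x.
Proof.
move=> seqf; apply/cvg_ballP => e e0.
apply: contrapT => nfe.
have bad (n : nat) : exists y, ball x n.+1%:R^-1 y /\ ~ ball (f x) e (f y).
  apply: contrapT => h; apply: nfe.
  apply/nbhs_ballP; exists n.+1%:R^-1; first by rewrite /= invr_gt0.
  by move=> y xy /=; apply: contrapT => nb; apply: h; exists y.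
have [u uP] := choice bad.
have ux : u n @[n --> \oo] --> x.
  apply/cvg_ballP => d d0; near=> n.
  apply: (@le_ball _ _ x n.+1%:R^-1); last by have [] := uP n.
  rewrite ltW//; near: n; exact: near_infty_natSinv_lt (PosNum d0).
have /cvg_ballP/(_ e e0) [N _ /(_ N (leqnn N))] := seqf u ux.
by have [] := uP N.
Unshelve. all: by end_near. Qed.

Lemma sup_argmax (T : Type) (A : set T) (f : T -> R) a :
  argmax_on A f a -> sup [set f b | b in A] = f a.
Proof.
move=> [Aa maxa]; apply/eqP; rewrite eq_le; apply/andP; split.
  by apply: ge_sup; [exists (f a), a|move=> _ [b Ab <-]; exact: maxa].
apply: ub_le_sup; last by exists a.
by exists (f a) => _ [b Ab <-]; exact: maxa.
Qed.

Section Parametric.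
Context {S T : topologicalType}.
Variables (A : set T) (F : S -> T -> R).
Hypotheses (A0 : A !=set0) (cA : compact A).
Hypothesis cF : continuous (fun z : S * T => F z.1 z.2).

Lemma argmax_nonempty s : argmax_on A (F s) !=set0.
Proof.
have cFs : {within A, continuous (F s)}.
  apply: continuous_subspaceT => a.
  have ca : (s, b) @[b --> a] --> (s, a).
    by apply: cvg_pair; [exact: cvg_cst|exact: cvg_id].
  exact: (cvg_comp _ _ ca (@cF (s, a))).
have [m mA mP] := compact_EVT_max A0 cA cFs.
by exists m; split; [exact/set_mem|move=> b Ab; apply: mP; exact/mem_set].
Qed.

(** Continuity at [(s, a)] controls both [F s'] and [F s] near [a]; compactness of [A] makes the
    neighbourhood of [s] common to all [a]. *)
Lemma near_uniform_on s (e : R) : 0 < e ->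
  \forall s' \near s, forall a, A a -> `|F s' a - F s a| < e.
Proof.
move=> e0; pose P s' a := `|F s' a - F s a| < e.
apply: ((compact_near_coveringP A).1 cA _ _ P) => a Aa.
have e20 : 0 < e / 2 by rewrite divr_gt0.
have /cvgrPdist_lt/(_ _ e20) [[U V] [/= sU aV] UV] := @cF (s, a).
exists (V, U); first by split.
move=> [b t] [/= Vb Ut]; rewrite /P.
have h1 := UV (t, b) (conj Ut Vb).
have h2 := UV (s, b) (conj (nbhs_singleton sU) Vb).
rewrite /= in h1 h2.
rewrite (splitr e) -(subrKA (F s a)) (le_lt_trans (ler_normD _ _))//.
by rewrite ltrD// distrC.
Qed.

Lemma continuous_sup_compact :
  continuous (fun s => sup [set F s a | a in A]).
Proof.
move=> s; apply/cvgrPdist_le => e e0.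
near=> t; have near_t : forall a, A a -> `|F t a - F s a| < e.
  by near: t; exact: near_uniform_on.
have [a amax] := argmax_nonempty s; have [b bmax] := argmax_nonempty t.
rewrite (sup_argmax amax) (sup_argmax bmax).
have := near_t _ amax.1; have := near_t _ bmax.1.
have := amax.2 _ bmax.1; have := bmax.2 _ amax.1.
rewrite !ltr_norml ler_norml; lra.
Unshelve. all: by end_near. Qed.

(** Fix a maximiser [m] at [s]. Points of the compact set [A] minus [U] are strictly worse than [m]
    at [s], and by compactness remain so at all nearby parameters. *)
Lemma argmax_upper_hemicontinuous s (U : set T) : open U ->
  argmax_on A (F s) `<=` U -> \forall t \near s, argmax_on A (F t) `<=` U.
Proof.
move=> oU maxU; have [m [Am maxm]] := argmax_nonempty s.
have cAU : compact (A `&` ~` U).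
  by apply: compact_closedI => //; exact: open_closedC.
pose P t a := F t a < F t m.
suff : \near s, A `&` ~` U `<=` P s.
  apply: filterS => t APt a [Aa maxa]; apply: contrapT => Ua.
  have := APt a (conj Aa Ua); rewrite /P ltNge => /negP; apply; exact: maxa.
apply: ((compact_near_coveringP _).1 cAU _ _ P) => a [Aa nUa].
have Fam : F s a < F s m.
  rewrite lt_neqAle maxm// andbT; apply/eqP => Fam; apply: nUa; apply: maxU.
  by split => // b Ab; rewrite Fam; exact: maxm.
pose e := (F s m - F s a) / 2.
have e0 : 0 < e by rewrite divr_gt0// subr_gt0.
have /cvgrPdist_lt/(_ _ e0) [[U1 V1] [/= sU1 aV1] UV1] := @cF (s, a).
have /cvgrPdist_lt/(_ _ e0) [[U2 V2] [/= sU2 mV2] UV2] := @cF (s, m).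
exists (V1, U1 `&` U2); first by split=> //; exact: filterI.
move=> [b t] [/= Vb [Ut1 Ut2]]; rewrite /P.
have := UV1 (t, b) (conj Ut1 Vb).
have := UV2 (t, m) (conj Ut2 (nbhs_singleton mV2)).
rewrite /= !ltr_norml /e; lra.
Qed.

End Parametric.

Lemma sup_dist (T : Type) (A : set T) (f g : T -> R) (c : R) :
  argmax_on A f !=set0 -> argmax_on A g !=set0 ->
  (forall a, A a -> `|f a - g a| <= c) ->
  `|sup [set f a | a in A] - sup [set g a | a in A]| <= c.
Proof.
move=> [a amax] [b bmax] fg.
rewrite (sup_argmax amax) (sup_argmax bmax).
have := fg _ amax.1; have := fg _ bmax.1.
have := amax.2 _ bmax.1; have := bmax.2 _ amax.1.
rewrite !ler_norml; lra.
Qed.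

(* The limit of the iterates is the supremum of their lower confidence bounds
   [f_n - c_n], where [c_n] bounds the distance from the n-th iterate to all later ones. *)
Lemma contraction_fixed_point (S : Type) (D : set S) (P : set (S -> R))
    (op : (S -> R) -> S -> R) (b B : R) (f0 : S -> R) :
  0 <= b -> b < 1 -> P f0 ->
  (forall f, P f -> P (op f)) ->
  (forall f s, P f -> D s -> `|f s| <= B) ->
  (forall f g (c : R), P f -> P g -> (forall s, D s -> `|f s - g s| <= c) ->
     forall s, D s -> `|op f s - op g s| <= b * c) ->
  (forall (f_ : nat -> S -> R) f, (forall n, P (f_ n)) ->
     (forall e : R, 0 < e -> exists n, forall s, D s -> `|f_ n s - f s| <= e) -> P f) ->
  exists2 f, P f & forall s, D s -> op f s = f s.
Proof.
move=> b0 b1 Pf0 Pop PB contr Pclosed.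
pose f_ n := iter n op f0.
pose c n := b ^+ n * (2 * B).
have Pf n : P (f_ n) by elim: n => [//|n ih]; exact: Pop.
(* Two members of [P] differ by at most [2 * B] on [D], and each application of [op] shrinks the
   distance by [b]. *)
have cauchy n k s : D s -> `|f_ (n + k)%N s - f_ n s| <= c n.
  elim: n s => [|n ih] s Ds.
    rewrite add0n /c expr0 mul1r (le_trans (ler_normB _ _))//.
    by rewrite mulr_natl mulr2n lerD// PB.
  rewrite addSn /c exprS -mulrA /f_ !iterS; apply: contr => //; exact: Pf.
have cle s n m : D s -> f_ m s - c m <= f_ n s + c n.
  have c0 k : D s -> 0 <= c k by move=> Ds; apply: le_trans (cauchy k 0%N s Ds).
  move=> Ds; have [/subnKC nm|/ltnW/subnKC nm] := leqP n m.
    have := cauchy n (m - n)%N s Ds; rewrite nm ler_norml.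
    have := c0 m Ds; have := c0 n Ds; lra.
  have := cauchy m (n - m)%N s Ds; rewrite nm ler_norml.
  have := c0 m Ds; have := c0 n Ds; lra.
pose f s := sup [set f_ n s - c n | n in setT].
have fnear n s : D s -> `|f_ n s - f s| <= c n.
  move=> Ds; rewrite ler_norml.
  have h1 : f_ n s - c n <= f s.
    apply: ub_le_sup; last by exists n.
    by exists (f_ 0%N s + c 0%N) => _ [m _ <-]; exact: cle.
  have h2 : f s <= f_ n s + c n.
    apply: ge_sup; first by exists (f_ 0%N s - c 0%N), 0%N.
    by move=> _ [m _ <-]; exact: cle.
  lra.
have c_small e : 0 < e -> exists n, c n <= e.
  move=> e0; have cv : c n @[n --> \oo] --> 0 * (2 * B).
    apply: cvgMl; apply: cvg_expr; by rewrite ger0_norm.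
  move: cv; rewrite mul0r => /cvgrPdist_le/(_ e e0) [n _ /(_ n (leqnn n))] /=.
  by rewrite sub0r normrN ler_norml => /andP[_ ?]; exists n.
have Pff : P f.
  apply: (Pclosed f_) => // e /c_small [n cne]; exists n => s Ds.
  exact: le_trans (fnear n s Ds) cne.
(* If the gap between [op f s] and [f s] were nonzero, taking [c n] at most a quarter of it would
   bound the gap by [2 * b * c n], hence by half of itself. *)
exists f => // s Ds; apply: contrapT => /eqP ff.
pose e := `|op f s - f s| / 2.
have e0 : 0 < e by rewrite divr_gt0// normr_gt0 subr_eq0.
have e20 : 0 < e / 2 by rewrite divr_gt0.
have [n cn] := c_small _ e20.
have fnear' t : D t -> `|f t - f_ n t| <= c n by rewrite distrC; exact: fnear.
have h1 := contr _ _ _ Pff (Pf n) fnear' s Ds.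
have h2 := fnear n.+1 s Ds.
have cS : c n.+1 = b * c n by rewrite /c exprS -mulrA.
have cn0 : 0 <= c n by apply: le_trans (fnear n s Ds).
have bc : b * c n <= c n by rewrite ler_piMl// ltW.
have := ler_normD (op f s - op (f_ n) s) (op (f_ n) s - f s).
rewrite subrKA; rewrite cS in h2.
have : `|op (f_ n) s - f s| <= b * c n by exact: h2.
move: e0 cn h1; rewrite /e; lra.
Qed.

End Optimisation.

(** * The Bellman operator *)

Section Clamp.
Context {R : realType}.

Definition clamp (lo hi x : R) : R := Num.max lo (Num.min hi x).

Lemma clamp_ge lo hi x : lo <= clamp lo hi x.
Proof. by rewrite /clamp le_max lexx. Qed.

Lemma clamp_le lo hi x : lo <= hi -> clamp lo hi x <= hi.
Proof. by move=> lh; rewrite /clamp ge_max lh ge_min lexx. Qed.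

Lemma clamp_id lo hi x : lo <= x <= hi -> clamp lo hi x = x.
Proof. by move=> /andP[lx xh]; rewrite /clamp (min_idPr xh) (max_idPr lx). Qed.

Lemma continuous_clamp lo hi : continuous (clamp lo hi).
Proof.
move=> x; apply: continuous_max; first exact: cvg_cst.
by apply: continuous_min; [exact: cvg_cst|exact: cvg_id].
Qed.

Lemma cvg_clamp (T : Type) (F : set_system T) {FF : Filter F} (f : T -> R)
    (lo hi l : R) :
  f t @[t --> F] --> l -> clamp lo hi (f t) @[t --> F] --> clamp lo hi l.
Proof. by move=> fl; apply: continuous_cvg fl; exact: continuous_clamp. Qed.

Lemma min_dist (m x y : R) : `|Num.min m x - Num.min m y| <= `|x - y|.
Proof.
have := ler_norm (x - y); have := ler_norm (y - x); rewrite distrC.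
by have [mx|xm] := leP m x; have [my|ym] := leP m y; rewrite ler_norml; lra.
Qed.

End Clamp.

(** * Projection onto the state box and continuity of the primitives *)

Section Model.
Context {R : realType} (p : primitives R).
Local Notation state := (@state R).
Implicit Types (W V : state -> R) (s : state).

Local Notation states := (states p).
Local Notation actions := (actions p).

(** A continuous retraction of the whole space onto the state box. Precomposing a member of [CX]
    with it gives a bounded continuous extension, which avoids subspace topologies. *)
Definition clamp_state s : state :=
  (clamp (Mlo p) (Mhi p) s.1.1, clamp 0 (rbar p) s.1.2,
   clamp (taulo p) (tauhi p) s.2).

Lemma states_clamp s : states (clamp_state s).
Proof.
by split; rewrite /= clamp_ge clamp_le ?Mlo_le_Mhi ?rbar_ge0 ?taulo_le_tauhi.
Qed.

Lemma clamp_state_id s : states s -> clamp_state s = s.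
Proof.
by case: s => [[M r] tau] [/= hM hr ht]; rewrite /clamp_state/= !clamp_id.
Qed.

Lemma cvg_state (T : Type) (F : set_system T) {FF : Filter F} (M r t : T -> R)
    (M0 r0 t0 : R) :
  M x @[x --> F] --> M0 -> r x @[x --> F] --> r0 -> t x @[x --> F] --> t0 ->
  (M x, r x, t x) @[x --> F] --> ((M0, r0, t0) : state).
Proof.
move=> MM rr tt.
apply: (@cvg_pair _ _ _ F (nbhs (M0, r0)) (nbhs t0)) => //.
exact: (@cvg_pair _ _ _ F (nbhs M0) (nbhs r0)).
Qed.

Lemma continuous_clamp_state : continuous clamp_state.
Proof.
move=> s; have c1 : t.1 @[t --> s] --> s.1 by exact: cvg_fst.
have c11 : t.1.1 @[t --> s] --> s.1.1  by exact: cvg_comp c1 cvg_fst.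
have c12 : t.1.2 @[t --> s] --> s.1.2  by exact: cvg_comp c1 cvg_snd.
have c2 : t.2 @[t --> s] --> s.2 by exact: cvg_snd.
exact: (@cvg_state _ _ _ _ _ _ _ _ _ (cvg_clamp c11) (cvg_clamp c12) (cvg_clamp c2)).
Qed.

Lemma CX_clamp W : CX p W ->
  continuous (W \o clamp_state) /\ exists B, forall s, `|(W \o clamp_state) s| <= B.
Proof.
move=> [cW [B [_ bW]]]; split; last first.
  exists (B + 1) => s /=; apply: bW; first by rewrite ltrDl.
  exact: states_clamp.
move=> s; move/subspace_continuousP : cW => /(_ _ (states_clamp s)).
apply: cvg_comp => U /= /(continuous_clamp_state (x := s)).
by rewrite /nbhs/=; apply: filterS => t /(_ (states_clamp t)).
Qed.

Lemma kappa_tau_gt0 (tau : R) : 0 < tau -> 0 < tau + kappa p.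
Proof. by move=> t0; rewrite addr_gt0// kappa_gt0. Qed.

Lemma omega_gt0 (tau : R) : 0 < tau -> 0 < omega p tau.
Proof.
by move=> t0; rewrite divr_gt0 ?kappa_tau_gt0// sqrtr_gt0 mulr_gt0// kappa_gt0.
Qed.

Lemma states_tau_gt0 s : states s -> 0 < s.2.
Proof. by move=> [_ _ /andP[+ _]]; apply: lt_le_trans; exact: taulo_gt0. Qed.

Lemma omega_le (t u : R) : 0 < t -> t <= u -> omega p u <= omega p t.
Proof.
move=> t0 tu; have u0 := lt_le_trans t0 tu.
rewrite ler_wpM2l ?sqrtr_ge0// lef_pV2 ?posrE ?kappa_tau_gt0//.
by rewrite lerD2r.
Qed.

Lemma trade_prob01 (a r tau : R) : 0 <= trade_prob p a r tau <= 1.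
Proof. by rewrite ncdf_ge0 ncdf_le1. Qed.

Lemma states_next_tau (tau : R) : taulo p <= tau <= tauhi p ->
  taulo p <= next_tau p tau <= tauhi p.
Proof.
move=> /andP[lt th]; rewrite /next_tau le_min ge_min lexx/= taulo_le_tauhi/=.
by rewrite andbT (le_trans lt)// lerDl ltW// tauz_gt0.
Qed.

Lemma states_next_r (r a : R) : 0 <= r -> 0 <= a -> 0 <= next_r p r a <= rbar p.
Proof.
move=> r0 a0; rewrite /next_r le_min rbar_ge0 ge_min lexx/= andbT.
by rewrite addr_ge0// mulr_ge0// ?rho_ge0// ltW// gamma_gt0.
Qed.

Lemma states_next_M (M eta : R) : Mlo p <= next_M p M eta <= Mhi p.
Proof. by rewrite (clamp_ge (Mlo p)) (clamp_le _ (Mlo_le_Mhi p)). Qed.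

Lemma states_trade (M eta r' tau : R) :
  0 <= r' <= rbar p -> taulo p <= tau <= tauhi p ->
  states (next_M p M eta, r', next_tau p tau).
Proof. by move=> hr ht; split; rewrite /= ?states_next_M ?states_next_tau. Qed.

(** The standard deviation decreases in [tau], so over the box it stays between two positive bounds,
    as the domination of the Gaussian densities requires. *)
Lemma eta_sd_bounds (tau : R) : taulo p <= tau <= tauhi p ->
  [&& 0 < eta_sd p (tauhi p), eta_sd p (tauhi p) <= eta_sd p tau
    & eta_sd p tau <= eta_sd p (taulo p)].
Proof.
have z0 := tauz_gt0 p; have l0 := taulo_gt0 p.
have pos t : 0 < t -> 0 < t * (t + tauz p) by move=> t0; rewrite mulr_gt0// addr_gt0.
have anti t u : 0 < t -> t <= u -> eta_sd p u <= eta_sd p t.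
  move=> t0 tu; have u0 := lt_le_trans t0 tu.
  rewrite ler_wsqrtr// (ler_wpM2l (ltW z0))// lef_pV2 ?posrE ?pos//.
  by apply: ler_pM; rewrite ?lerD2r// ?ltW// addr_gt0.
move=> /andP[lt th]; have t0 := lt_le_trans l0 lt.
have h0 := lt_le_trans t0 th.
by rewrite sqrtr_gt0 divr_gt0 ?pos//= !anti.
Qed.

Lemma measurable_next W (M r' tau : R) : CX p W ->
  0 <= r' <= rbar p -> taulo p <= tau <= tauhi p ->
  measurable_fun setT (fun eta : R => W (next_M p M eta, r', next_tau p tau)).
Proof.
move=> cW hr ht; have [cWc _] := CX_clamp cW.
rewrite (_ : (fun _ => _) =
    fun eta => (W \o clamp_state) (next_M p M eta, r', next_tau p tau)); last first.
  by apply/funext => eta; rewrite /= clamp_state_id//; exact: states_trade.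
apply: continuous_measurable_fun => eta.
apply: (@continuous_cvg _ _ _ (nbhs eta) _
  (fun x => (next_M p M x, r', next_tau p tau)) (W \o clamp_state)); first exact: cWc.
apply: cvg_state; [|exact: cvg_cst|exact: cvg_cst].
by apply: cvg_clamp; apply: cvgD; [exact: cvg_cst|exact: cvg_id].
Qed.

(** From a state in the box every feasible action leads back into the box, with or without trade. *)
Lemma eq_objective W1 W2 : (forall s, states s -> W1 s = W2 s) ->
  forall s a, states s -> actions a -> objective p W1 s a = objective p W2 s a.
Proof.
move=> W12 [[M r] tau] a [/= hM hr ht] /andP[a0 _]; rewrite /objective /continuation.
have hr' := states_next_r (proj1 (andP hr)) a0.
rewrite [in LHS]W12; last by split.
congr (_ + _ * (_ * _ + _)); congr (Eeta p tau _).
by apply/funext => eta; rewrite W12//; exact: states_trade.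
Qed.

Section Sequences.
Variables (M_ r_ t_ a_ : R^nat) (M r t a : R).
Hypotheses (ht_ : forall n, taulo p <= t_ n <= tauhi p).
Hypotheses (MM : M_ n @[n --> \oo] --> M) (rr : r_ n @[n --> \oo] --> r)
  (tt : t_ n @[n --> \oo] --> t) (aa : a_ n @[n --> \oo] --> a).

Let ht : taulo p <= t <= tauhi p.
Proof.
apply/andP; split; [apply: (cvgr_to_ge tt)|apply: (cvgr_to_le tt)];
  by apply: nearW => n; have /andP[] := ht_ n.
Qed.

Let t0 : 0 < t.
Proof. by have /andP[+ _] := ht; apply: lt_le_trans; exact: taulo_gt0. Qed.

Let cvg_omega : omega p (t_ n) @[n --> \oo] --> omega p t.
Proof.
apply: cvgMr; apply: cvgV; first by rewrite gt_eqF// kappa_tau_gt0.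
by apply: cvgD => //; exact: cvg_cst.
Qed.

Let cvg_kfun : kfun p (a_ n) (r_ n) (t_ n) @[n --> \oo] --> kfun p a r t.
Proof.
apply: cvgM; last by apply: cvgV; rewrite // gt_eqF// omega_gt0.
apply: cvgB; last exact: cvgMr.
by apply: cvgB => //; exact: cvg_cst.
Qed.

Let cvg_trade_prob :
  trade_prob p (a_ n) (r_ n) (t_ n) @[n --> \oo] --> trade_prob p a r t.
Proof. by apply: (@continuous_cvg _ _ _ _ _ _ (@ncdf R)) => //; exact: continuous_ncdf. Qed.

Lemma cvg_profit :
  profit p (M_ n) (a_ n) (r_ n) (t_ n) @[n --> \oo] --> profit p M a r t.
Proof.
apply: cvgB; apply: cvgM.
- exact: cvgD.
- exact: cvg_trade_prob.
- exact: cvgMl.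
- by apply: (@continuous_cvg _ _ _ _ _ _ (@npdf R)) => //; exact: continuous_npdf.
Qed.

Lemma cvg_continuation W (B : R) : continuous W -> (forall s, `|W s| <= B) ->
  continuation p W (M_ n) (a_ n) (r_ n) (t_ n) @[n --> \oo] -->
  continuation p W M a r t.
Proof.
move=> cW WB.
have cvg_r' : next_r p (r_ n) (a_ n) @[n --> \oo] --> next_r p r a.
  apply: (@continuous_cvg _ _ _ _ _ _ (Num.min (rbar p))).
    by apply: continuous_min; [exact: cvg_cst|exact: cvg_id].
  by apply: cvgD; apply: cvgMr.
have cvg_t' : next_tau p (t_ n) @[n --> \oo] --> next_tau p t.
  apply: (@continuous_cvg _ _ _ _ _ _ (Num.min (tauhi p))).
    by apply: continuous_min; [exact: cvg_cst|exact: cvg_id].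
  by apply: cvgD => //; exact: cvg_cst.
have mW (m r' t' : R) : measurable_fun setT (fun eta : R => W (next_M p m eta, r', t')).
  apply: continuous_measurable_fun => eta.
  apply: (@continuous_cvg _ _ _ _ _ _ W); first exact: cW.
  apply: cvg_state; [|exact: cvg_cst|exact: cvg_cst].
  by apply: cvg_clamp; apply: cvgD; [exact: cvg_cst|exact: cvg_id].
have bounds n : eta_sd p (tauhi p) <= eta_sd p (t_ n) <= eta_sd p (taulo p).
  by have /and3P[_ -> ->] := eta_sd_bounds (ht_ n).
apply: cvgD; apply: cvgM => //.
(* The state moves both the integrand and the standard deviation of the shock. *)
- apply: (@normal_expectation_cvg _ _ _ (eta_sd p (tauhi p)) (eta_sd p (taulo p)) B) => //.
  + by have /and3P[] := eta_sd_bounds ht.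
  + apply: (@continuous_cvg _ _ _ _ _ _ (@Num.sqrt R)); first exact: sqrt_continuous.
    apply: cvgMr; apply: cvgV.
      by rewrite gt_eqF// mulr_gt0// addr_gt0// tauz_gt0.
    by apply: cvgM => //; apply: cvgD => //; exact: cvg_cst.
  + move=> eta; apply: (@continuous_cvg _ _ _ _ _ _ W); first exact: cW.
    apply: cvg_state => //; apply: cvg_clamp; apply: cvgD => //; exact: cvg_cst.
- by apply: cvgB => //; exact: cvg_cst.
- by apply: (@continuous_cvg _ _ _ _ _ _ W); [exact: cW|exact: cvg_state].
Qed.

End Sequences.

End Model.

(** * Contraction, optimal policies and the trust-Lipschitz value function *)

Section Bellman.
Context {R : realType} (p : primitives R).
Local Notation state := (@state R).
Local Notation states := (states p).
Local Notation actions := (actions p).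
Implicit Types (W V : state -> R) (s : state).

Lemma actions_nonempty : actions !=set0.
Proof. by exists 0; rewrite /actions/= lexx abar_ge0. Qed.

Lemma compact_actions : compact actions.
Proof.
rewrite (_ : actions = `[0, abar p]%classic); first exact: segment_compact.
by apply/seteqP; split => x; rewrite /= in_itv.
Qed.

(** State and continuation function are both projected onto the box, which makes the objective
    continuous on the whole product without changing it at feasible pairs. *)
Let obj W (s : state) (a : R) := objective p (W \o clamp_state p) (clamp_state p s) a.

Let obj_objective W s a : states s -> actions a -> obj W s a = objective p W s a.
Proof.
move=> ss aa; rewrite /obj clamp_state_id//; apply: (eq_objective (p := p)) => // t st.
by rewrite /= clamp_state_id.
Qed.

Let continuous_obj W : CX p W -> continuous (fun z : state * R => obj W z.1 z.2).
Proof.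
move=> /CX_clamp[cW [B WB]] z; apply: seq_continuous_at => u uz.
have u1 : (u n).1 @[n --> \oo] --> z.1 by apply: (cvg_comp _ fst uz); exact: cvg_fst.
have u2 : (u n).2 @[n --> \oo] --> z.2 by apply: (cvg_comp _ snd uz); exact: cvg_snd.
have uc : clamp_state p (u n).1 @[n --> \oo] --> clamp_state p z.1.
  exact: (cvg_comp _ _ u1 (@continuous_clamp_state _ p z.1)).
have uc1 : (clamp_state p (u n).1).1 @[n --> \oo] --> (clamp_state p z.1).1.
  by apply: (cvg_comp _ fst uc); exact: cvg_fst.
have uc11 : (clamp_state p (u n).1).1.1 @[n --> \oo] --> (clamp_state p z.1).1.1.
  by apply: (cvg_comp _ fst uc1); exact: cvg_fst.
have uc12 : (clamp_state p (u n).1).1.2 @[n --> \oo] --> (clamp_state p z.1).1.2.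
  by apply: (cvg_comp _ snd uc1); exact: cvg_snd.
have uc2 : (clamp_state p (u n).1).2 @[n --> \oo] --> (clamp_state p z.1).2.
  by apply: (cvg_comp _ snd uc); exact: cvg_snd.
have ht n : taulo p <= (clamp_state p (u n).1).2 <= tauhi p.
  by have [] := states_clamp p (u n).1.
apply: cvgD; first exact: cvg_profit.
by apply: cvgMr; apply: (cvg_continuation ht _ _ _ _ cW WB).
Qed.

Let eq_image W s : states s ->
  [set obj W s a | a in actions] = [set objective p W s a | a in actions].
Proof.
by move=> ss; apply/seteqP; split => _ [a aa <-]; exists a; rewrite ?obj_objective.
Qed.

Let argmax_obj W s : states s -> argmax_on actions (obj W s) = policy p W s.
Proof.
move=> ss; apply/seteqP; split => a [aa amax]; split => // b bb.
  by rewrite -!obj_objective//; exact: amax.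
by rewrite !obj_objective//; exact: amax.
Qed.

Lemma policy_nonempty W s : CX p W -> states s -> policy p W s !=set0.
Proof.
move=> cW ss; rewrite -argmax_obj//.
exact: (argmax_nonempty actions_nonempty compact_actions (continuous_obj cW)).
Qed.

Lemma policy_upper_hemicontinuous W : CX p W ->
  upper_hemicontinuous states (policy p W).
Proof.
move=> cW s ss U oU; rewrite -argmax_obj// => sU.
have := argmax_upper_hemicontinuous actions_nonempty compact_actions
  (continuous_obj cW) oU sU.
by apply: filterS => t; rewrite /= => tU st; rewrite -argmax_obj.
Qed.

Lemma bellman_policy W s a : CX p W -> states s -> policy p W s a ->
  bellman p W s = objective p W s a.
Proof. by move=> cW ss; exact: sup_argmax. Qed.

Lemma bellman_near W1 W2 s1 s2 (c : R) : CX p W1 -> CX p W2 ->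
  states s1 -> states s2 ->
  (forall a, actions a -> `|objective p W1 s1 a - objective p W2 s2 a| <= c) ->
  `|bellman p W1 s1 - bellman p W2 s2| <= c.
Proof. by move=> c1 c2 h1 h2; apply: sup_dist; exact: policy_nonempty. Qed.

Lemma expectation_near W1 W2 (M1 M2 r1 r2 tau c : R) : CX p W1 -> CX p W2 ->
  0 <= r1 <= rbar p -> 0 <= r2 <= rbar p -> taulo p <= tau <= tauhi p ->
  (forall eta, `|W1 (next_M p M1 eta, r1, next_tau p tau)
                 - W2 (next_M p M2 eta, r2, next_tau p tau)| <= c) ->
  `|Eeta p tau (fun eta => W1 (next_M p M1 eta, r1, next_tau p tau))
    - Eeta p tau (fun eta => W2 (next_M p M2 eta, r2, next_tau p tau))| <= c.
Proof.
move=> c1 c2 h1 h2 ht hc.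
have bnd W : CX p W -> exists B, forall s, states s -> `|W s| <= B.
  move=> [_ [B [_ WB]]]; exists (B + 1) => s ss; apply: WB => //.
  by rewrite ltrDl.
have [B1 WB1] := bnd _ c1; have [B2 WB2] := bnd _ c2.
apply: (@fine_expectation_near _ _ _ _ (Num.max B1 B2)) => //.
- exact: measurable_next.
- exact: measurable_next.
- by move=> eta; rewrite le_max WB1//; exact: states_trade.
- by move=> eta; rewrite le_max WB2 ?orbT//; exact: states_trade.
Qed.

Lemma expectation_norm_le W (M r tau B : R) : CX p W ->
  0 <= r <= rbar p -> taulo p <= tau <= tauhi p ->
  (forall s, states s -> `|W s| <= B) ->
  `|Eeta p tau (fun eta => W (next_M p M eta, r, next_tau p tau))| <= B.
Proof.
move=> cW hr ht WB; apply: fine_expectation_norm_le; first exact: measurable_next.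
by move=> eta; apply: WB; exact: states_trade.
Qed.

Lemma objective_contraction W1 W2 s a (c : R) : CX p W1 -> CX p W2 ->
  states s -> actions a -> (forall s, states s -> `|W1 s - W2 s| <= c) ->
  `|objective p W1 s a - objective p W2 s a| <= beta p * c.
Proof.
case: s => [[M r] tau] c1 c2 [/= hM hr ht] /andP[a0 _] W12.
have hr' := states_next_r p (proj1 (andP hr)) a0.
have := expectation_near (M1 := M) (M2 := M) c1 c2 hr' hr' ht
  (fun eta => W12 _ (states_trade M eta hr' ht)).
have : `|W1 (M, next_r p r a, tau) - W2 (M, next_r p r a, tau)| <= c.
  by apply: W12; split.
rewrite /continuation; set E1 := Eeta _ _ _; set E2 := Eeta _ _ _.
set Z1 := W1 _; set Z2 := W2 _.
have /andP[] := trade_prob01 p a r tau; set D := trade_prob _ _ _ _ => D0 D1 hZ hE.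
(* Profit cancels; what remains is [beta] times a convex combination of two differences of size at
   most [c]. *)
rewrite opprD addrACA subrr add0r -mulrBr normrM (gtr0_norm (beta_gt0 p)).
rewrite ler_wpM2l ?(ltW (beta_gt0 p))//.
move: hZ hE; rewrite !ler_norml => /andP[hZ1 hZ2] /andP[hE1 hE2].
by apply/andP; split; nra.
Qed.

Lemma bellman_contraction W1 W2 s (c : R) : CX p W1 -> CX p W2 -> states s ->
  (forall s, states s -> `|W1 s - W2 s| <= c) ->
  `|bellman p W1 s - bellman p W2 s| <= beta p * c.
Proof.
by move=> c1 c2 ss W12; apply: bellman_near => // a aa; exact: objective_contraction.
Qed.

Lemma profit_bound : exists K, 0 <= K /\ forall M a r tau,
  states (M, r, tau) -> actions a -> `|profit p M a r tau| <= K.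
Proof.
pose Mb := `|Mlo p| + `|Mhi p|.
(* [omega] is largest at the lowest precision, and the normal density is at most its peak. *)
exists ((Mb + abar p) + omega p (taulo p) / 2 * normal_peak 1); split.
  apply: addr_ge0; first by rewrite !addr_ge0// abar_ge0.
  apply: mulr_ge0; last exact: normal_peak_ge0.
  by apply: divr_ge0 => //; apply: ltW; apply: omega_gt0; exact: taulo_gt0.
move=> M a r tau [/= hM hr /andP[lt th]] /andP[a0 ab].
have l0 := taulo_gt0 p.
have oo := omega_le p l0 lt.
have o0 := omega_gt0 p (lt_le_trans l0 lt).
have n0 := npdf_gt0 (kfun p a r tau); have nle := npdf_le (kfun p a r tau).
have D0 := ncdf_ge0 (kfun p a r tau); have D1 := ncdf_le1 (kfun p a r tau).
rewrite /profit; apply: le_trans (ler_normB _ _) _; apply: lerD.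
  rewrite normrM (ger0_norm D0); apply: (le_trans (ler_piMr _ D1)) => //.
  apply: le_trans (ler_normD _ _) _; rewrite (ger0_norm a0) lerD//.
  rewrite /Mb; move: hM => /andP[h1 h2].
  have := ler_norm (Mhi p); have := ler_norm (- Mlo p); rewrite normrN.
  have := normr_ge0 (Mhi p); have := normr_ge0 (Mlo p).
  rewrite ler_norml; lra.
have ow0 : 0 <= omega p tau / 2 by apply: divr_ge0 => //; exact: ltW.
rewrite normrM (gtr0_norm n0) (ger0_norm ow0).
by apply: ler_pM => //; [exact: ltW|rewrite ler_pM2r// invr_gt0].
Qed.

Lemma CX_bounded W : CX p W -> exists B, forall s, states s -> `|W s| <= B.
Proof.
move=> [_ [B [_ WB]]]; exists (B + 1) => s ss; apply: WB => //.
by rewrite ltrDl.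
Qed.

Lemma objective_norm_le (K B : R) W s a :
  (forall M a r tau, states (M, r, tau) -> actions a -> `|profit p M a r tau| <= K) ->
  CX p W -> (forall s, states s -> `|W s| <= B) -> states s -> actions a ->
  `|objective p W s a| <= K + beta p * B.
Proof.
case: s => [[M r] tau] hK cW WB ss aa; have [/= hM hr ht] := ss.
have /andP[a0 _] := aa.
have hr' := states_next_r p (proj1 (andP hr)) a0.
apply: le_trans (ler_normD _ _) _; apply: lerD; first exact: hK.
rewrite normrM (gtr0_norm (beta_gt0 p)) ler_wpM2l ?(ltW (beta_gt0 p))//.
have := expectation_norm_le M cW hr' ht WB.
have : `|W (M, next_r p r a, tau)| <= B by apply: WB; split.
rewrite /continuation; set E := Eeta _ _ _; set Z := W _.
have /andP[] := trade_prob01 p a r tau; set D := trade_prob _ _ _ _ => D0 D1.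
rewrite !ler_norml => /andP[hZ1 hZ2] /andP[hE1 hE2].
by apply/andP; split; nra.
Qed.

Lemma bellman_norm_le (K B : R) W s :
  (forall M a r tau, states (M, r, tau) -> actions a -> `|profit p M a r tau| <= K) ->
  CX p W -> (forall s, states s -> `|W s| <= B) -> states s ->
  `|bellman p W s| <= K + beta p * B.
Proof.
move=> hK cW WB ss; have [a amax] := policy_nonempty cW ss.
by rewrite (bellman_policy cW ss amax) (objective_norm_le hK)//; case: amax.
Qed.

(** Berge's theorem for the projected objective gives a function continuous on the whole space; on
    the box it agrees with [bellman p W]. *)
Lemma CX_bellman W : CX p W -> CX p (bellman p W).
Proof.
move=> cW; split; last first.
  have [K [_ hK]] := profit_bound; have [B WB] := CX_bounded cW.
  exists (K + beta p * B); split; rewrite ?num_real// => C KC s ss.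
  exact: le_trans (bellman_norm_le hK cW WB ss) (ltW KC).
apply/subspace_continuousP => s ss.
have c := continuous_sup_compact actions_nonempty compact_actions (continuous_obj cW).
have E t : states t -> bellman p W t = sup [set obj W t a | a in actions].
  by move=> st; rewrite /bellman eq_image.
rewrite /from_subspace (E s ss).
apply/cvgrPdist_le => e e0; have /cvgrPdist_le/(_ e e0) := c s.
by rewrite near_withinE; apply: filterS => t ht st; rewrite E.
Qed.

Lemma kfun_lipschitz : exists K, 0 <= K /\ forall a r1 r2 tau,
  taulo p <= tau <= tauhi p ->
  `|kfun p a r1 tau - kfun p a r2 tau| <= K * `|r1 - r2|.
Proof.
have h0 := lt_le_trans (taulo_gt0 p) (taulo_le_tauhi p).
(* [kfun] is affine in [r] with slope [- chi / omega], and [omega] is smallest at the highest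
   precision. *)
exists (`|chi p| / omega p (tauhi p)); split.
  by apply: divr_ge0 => //; apply: ltW; exact: omega_gt0.
move=> a r1 r2 tau /andP[lt th]; have t0 := lt_le_trans (taulo_gt0 p) lt.
rewrite /kfun -mulrBl /hfun.
rewrite (_ : _ - _ - _ - _ - _ = - (chi p * (r1 - r2))); last by ring.
rewrite normrM normrN normrM [leRHS]mulrAC.
apply: ler_wpM2l; first by rewrite mulr_ge0.
rewrite ger0_norm ?invr_ge0; last by rewrite ltW// omega_gt0.
by rewrite lef_pV2 ?posrE ?omega_gt0// omega_le.
Qed.

Lemma trade_prob_lipschitz : exists K, 0 <= K /\ forall a r1 r2 tau,
  taulo p <= tau <= tauhi p ->
  `|trade_prob p a r1 tau - trade_prob p a r2 tau| <= K * `|r1 - r2|.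
Proof.
have [K [K0 hK]] := kfun_lipschitz.
exists (normal_peak 1 * K); split; first by rewrite mulr_ge0// normal_peak_ge0.
move=> a r1 r2 tau ht; apply: le_trans (ncdf_lipschitz _ _) _.
by rewrite -mulrA ler_wpM2l ?normal_peak_ge0// hK.
Qed.

Lemma profit_lipschitz : exists K, 0 <= K /\ forall M a r1 r2 tau,
  states (M, r1, tau) -> actions a ->
  `|profit p M a r1 tau - profit p M a r2 tau| <= K * `|r1 - r2|.
Proof.
have [K [K0 hK]] := kfun_lipschitz; have [D [D0 hD]] := trade_prob_lipschitz.
pose Mb := `|Mlo p| + `|Mhi p|.
have l0 := taulo_gt0 p; have ol0 := omega_gt0 p l0.
exists ((Mb + abar p) * D + omega p (taulo p) / 2 * (normal_peak 1 * K)); split.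
  apply: addr_ge0; first by rewrite mulr_ge0// !addr_ge0// abar_ge0.
  apply: mulr_ge0; last by rewrite mulr_ge0// normal_peak_ge0.
  by apply: divr_ge0 => //; exact: ltW.
move=> M a r1 r2 tau [/= hM _ ht] /andP[a0 ab].
have /andP[lt th] := ht.
have oo := omega_le p l0 lt.
have o0 := omega_gt0 p (lt_le_trans l0 lt).
have ow0 : 0 <= omega p tau / 2 by apply: divr_ge0 => //; exact: ltW.
rewrite (_ : _ - _ = (M + a) * (trade_prob p a r1 tau - trade_prob p a r2 tau)
    - omega p tau / 2 * (npdf (kfun p a r1 tau) - npdf (kfun p a r2 tau))); last first.
  by rewrite /profit /trade_prob; ring.
apply: le_trans (ler_normB _ _) _.
rewrite [leRHS]mulrDl (normrM (M + a)) (normrM (omega p tau / 2)) (ger0_norm ow0).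
rewrite -(mulrA _ D) -(mulrA _ (_ * K)); apply: lerD.
  apply: ler_pM => //; last exact: hD.
  apply: le_trans (ler_normD _ _) _; rewrite (ger0_norm a0) lerD//.
  rewrite /Mb; move: hM => /andP[h1 h2].
  have := ler_norm (Mhi p); have := ler_norm (- Mlo p); rewrite normrN.
  have := normr_ge0 (Mhi p); have := normr_ge0 (Mlo p).
  rewrite ler_norml; lra.
apply: ler_pM => //; first by rewrite ler_pM2r// invr_gt0.
rewrite -mulrA; apply: le_trans (npdf_lipschitz _ _) _.
by rewrite ler_wpM2l ?normal_peak_ge0// hK.
Qed.

Definition lipschitz_in_trust (L : R) W := forall M r1 r2 tau,
  states (M, r1, tau) -> states (M, r2, tau) ->
  `|W (M, r1, tau) - W (M, r2, tau)| <= L * `|r1 - r2|.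

(** A displacement of current trust reaches the next trust state multiplied by at most [rho], and a
    change in trade probability shifts weight between two values at most [2 * B] apart. *)
Lemma bellman_lipschitz_in_trust (Kp Kd L B : R) W : 0 <= B -> 0 <= L ->
  (forall M a r1 r2 tau, states (M, r1, tau) -> actions a ->
    `|profit p M a r1 tau - profit p M a r2 tau| <= Kp * `|r1 - r2|) ->
  (forall a r1 r2 tau, taulo p <= tau <= tauhi p ->
    `|trade_prob p a r1 tau - trade_prob p a r2 tau| <= Kd * `|r1 - r2|) ->
  CX p W -> (forall s, states s -> `|W s| <= B) -> lipschitz_in_trust L W ->
  lipschitz_in_trust (Kp + beta p * (2 * B * Kd + L * rho p)) (bellman p W).
Proof.
move=> B0 L0 hp hd cW WB WL M r1 r2 tau s1 s2; apply: bellman_near => // a aa.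
have [/= hM hr1 ht] := s1; have [/= _ hr2 _] := s2; have /andP[a0 _] := aa.
have hr1' := states_next_r p (proj1 (andP hr1)) a0.
have hr2' := states_next_r p (proj1 (andP hr2)) a0.
have dr' : `|next_r p r1 a - next_r p r2 a| <= rho p * `|r1 - r2|.
  apply: le_trans (min_dist _ _ _) _.
  by rewrite opprD addrACA subrr addr0 -mulrBr normrM (ger0_norm (rho_ge0 p)).
have dW m t : Mlo p <= m <= Mhi p -> taulo p <= t <= tauhi p ->
    `|W (m, next_r p r1 a, t) - W (m, next_r p r2 a, t)| <= L * (rho p * `|r1 - r2|).
  move=> hm h; apply: (le_trans (WL _ _ _ _ _ _)); [by split..|].
  exact: ler_wpM2l.
have hE := expectation_near cW cW hr1' hr2' ht
  (fun eta => dW _ _ (states_next_M p M eta) (states_next_tau ht)).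
have hZ := dW _ _ hM ht.
have bE := expectation_norm_le M cW hr1' ht WB.
have bZ : `|W (M, next_r p r1 a, tau)| <= B by apply: WB; split.
have hPi := hp M a r1 r2 tau s1 aa.
have hD := hd a r1 r2 tau ht.
have /andP[D20 D21] := trade_prob01 p a r2 tau.
rewrite /objective /continuation.
move: hE hZ bE bZ hPi hD D20 D21.
set E1 := Eeta _ _ _; set E2 := Eeta _ _ _; set Z1 := W _; set Z2 := W _.
set D1 := trade_prob _ _ _ _; set D2 := trade_prob _ _ _ _.
set P1 := profit _ _ _ _ _; set P2 := profit _ _ _ _ _; set d := `|r1 - r2|.
move=> hE hZ bE bZ hPi hD D20 D21.
(* The factor [D1 - D2] isolates the change in trade probability; the rest of the continuation is a
   convex combination, weighted by [D2], of changes in value. *)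
rewrite (_ : _ - _ = (P1 - P2) + beta p * ((D1 - D2) * (E1 - Z1)
   + (D2 * (E1 - E2) + (1 - D2) * (Z1 - Z2)))); last by ring.
apply: le_trans (ler_normD _ _) _; rewrite [leRHS]mulrDl; apply: lerD => //.
rewrite normrM (gtr0_norm (beta_gt0 p)) -mulrA ler_wpM2l ?(ltW (beta_gt0 p))//.
apply: le_trans (ler_normD _ _) _; rewrite [leRHS]mulrDl; apply: lerD.
  rewrite normrM mulrC -[leRHS]mulrA; apply: ler_pM => //.
  by apply: le_trans (ler_normB _ _) _; rewrite mulr_natl mulr2n lerD.
rewrite -mulrA; move: hE hZ; set e := L * _.
rewrite !ler_norml => /andP[h1 h2] /andP[h3 h4]; apply/andP; split; nra.
Qed.

Lemma CX_uniform_limit (f_ : nat -> state -> R) f : (forall n, CX p (f_ n)) ->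
  (forall e : R, 0 < e -> exists n, forall s, states s -> `|f_ n s - f s| <= e) ->
  CX p f.
Proof.
move=> cf lim; split; last first.
  have [n hn] := lim _ ltr01; have [B fB] := CX_bounded (cf n).
  exists (B + 1); split; rewrite ?num_real// => C BC s ss.
  have := hn s ss; have := fB s ss.
  rewrite /= !ler_norml; lra.
apply/subspace_continuousP => s ss; apply/cvgrPdist_le => e e0.
have e30 : 0 < e / 3 by rewrite divr_gt0.
have [n hn] := lim _ e30.
have [/subspace_continuousP/(_ s ss) + _] := cf n.
move=> /cvgrPdist_le/(_ _ e30) h.
near=> t.
have st : states t by near: t; exact: withinT.
have ht : `|f_ n s - f_ n t| <= e / 3 by near: t.
have := hn s ss; have := hn t st; move: ht.
rewrite /from_subspace !ler_norml; lra.
Unshelve. all: by end_near. Qed.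

(** The iteration runs in the class of continuous functions with a fixed bound and a fixed Lipschitz
    constant in trust, which is closed under uniform limits. *)
Lemma value_function_exists :
  exists V L, [/\ value_function p V, 0 <= L & lipschitz_in_trust L V].
Proof.
have [K [K0 hK]] := profit_bound.
have [Kp [Kp0 hp]] := profit_lipschitz.
have [Kd [Kd0 hd]] := trade_prob_lipschitz.
have b0 := beta_gt0 p; have b1 := beta_lt1 p.
have r0 := rho_ge0 p; have r1 := rho_lt1 p.
have b1' : 0 < 1 - beta p by rewrite subr_gt0.
have br1 : 0 < 1 - beta p * rho p.
  by rewrite subr_gt0 (le_lt_trans (ler_piMr (ltW b0) (ltW r1))).
(* [B] solves [K + beta * B = B], so the operator preserves this bound. *)
pose B := K / (1 - beta p).
have B0 : 0 <= B by rewrite divr_ge0// ltW.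
have BE : K + beta p * B = B by rewrite /B; field; rewrite gt_eqF.
(* [L] solves the analogous equation for the Lipschitz constant; [beta * rho < 1] makes the solution
   nonnegative. *)
pose L := (Kp + beta p * (2 * B * Kd)) / (1 - beta p * rho p).
have L0 : 0 <= L.
  apply: divr_ge0; last exact: ltW.
  apply: addr_ge0 => //; apply: mulr_ge0; first exact: ltW.
  by apply: mulr_ge0 => //; apply: mulr_ge0.
have LE : Kp + beta p * (2 * B * Kd + L * rho p) = L.
  by rewrite /L; field; rewrite gt_eqF.
pose P : set (state -> R) := [set W | [/\ CX p W,
  forall s, states s -> `|W s| <= B & lipschitz_in_trust L W]].
have [|||||||V [cV _ VL] VE] := @contraction_fixed_point R state states P
    (bellman p) (beta p) B (fun=> 0).
- exact: ltW.
- exact: b1.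
- split=> [|s _|M t1 t2 tau _ _].
  2: by rewrite normr0.
  2: by rewrite subrr normr0; exact: mulr_ge0.
  split; first by apply: continuous_subspaceT => s; exact: cvg_cst.
  by exists 0; split; rewrite ?num_real// => C C0 s _; rewrite normr0 ltW.
- move=> W [cW WB WL]; split; first exact: CX_bellman.
    by move=> s ss; rewrite -BE; exact: bellman_norm_le hK cW WB ss.
  by rewrite -LE; exact: (bellman_lipschitz_in_trust B0 L0 hp hd cW WB WL).
- by move=> W s [_ WB _]; exact: WB.
- by move=> W1 W2 c [c1 _ _] [c2 _ _] W12 s ss; exact: bellman_contraction.
- move=> f_ f Pf lim; split.
  + by apply: (CX_uniform_limit _ lim) => n; have [] := Pf n.
  + move=> s ss; apply/ler_addgt0Pr => e e0; have [n hn] := lim _ e0.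
    have [_ /(_ s ss) + _] := Pf n; have := hn s ss.
    rewrite !ler_norml; lra.
  + move=> M t1 t2 tau s1 s2; apply/ler_addgt0Pr => e e0.
    have e20 : 0 < e / 2 by rewrite divr_gt0.
    have [n hn] := lim _ e20.
    have [_ _ /(_ _ _ _ _ s1 s2)] := Pf n.
    have := hn _ s1; have := hn _ s2.
    rewrite !ler_norml; lra.
exists V, L; split => //; split => // s /set_mem ss.
by rewrite VE.
Qed.

Lemma value_function_unique V1 V2 : value_function p V1 -> value_function p V2 ->
  {in states, V1 =1 V2}.
Proof.
move=> [c1 E1] [c2 E2].
have [B1 h1] := CX_bounded c1; have [B2 h2] := CX_bounded c2.
have step (n : nat) s : states s -> `|V1 s - V2 s| <= beta p ^+ n * (B1 + B2).
  elim: n s => [|n ih] s ss.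
    by rewrite expr0 mul1r (le_trans (ler_normB _ _))// lerD ?h1 ?h2.
  rewrite E1 ?E2 ?inE// exprS -mulrA; exact: bellman_contraction.
move=> s /set_mem ss; apply/eqP; rewrite -subr_eq0 -normr_le0.
have cv : beta p ^+ n * (B1 + B2) @[n --> \oo] --> 0 * (B1 + B2).
  by apply: cvgMl; apply: cvg_expr; rewrite gtr0_norm ?beta_gt0 ?beta_lt1.
rewrite mul0r in cv; apply: (cvgr_to_ge cv); apply: nearW => n.
exact: step.
Qed.

Lemma supnorm_le W (c : R) : (forall s, states s -> `|W s| <= c) -> supnorm p W <= c.
Proof.
move=> Wc; apply: ge_sup; last by move=> _ [s ss <-]; exact: Wc.
by exists `|W (clamp_state p (0, 0, 0))|; exists (clamp_state p (0, 0, 0)) => //;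
  exact: states_clamp.
Qed.

Lemma le_supnorm W s : (exists B, forall s, states s -> `|W s| <= B) -> states s ->
  `|W s| <= supnorm p W.
Proof.
move=> [B WB] ss; apply: ub_le_sup; last by exists s.
by exists B => _ [t st <-]; exact: WB.
Qed.

Lemma supnorm_contraction W1 W2 : CX p W1 -> CX p W2 ->
  supnorm p (fun s => bellman p W1 s - bellman p W2 s)
    <= beta p * supnorm p (fun s => W1 s - W2 s).
Proof.
move=> c1 c2; apply: supnorm_le => s ss; apply: bellman_contraction => // t st.
apply: (le_supnorm (W := fun s => W1 s - W2 s)) => //.
have [B1 h1] := CX_bounded c1; have [B2 h2] := CX_bounded c2.
by exists (B1 + B2) => u su; rewrite (le_trans (ler_normB _ _))// lerD ?h1 ?h2.
Qed.

End Bellman.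

(** * Difference quotients along sequences *)

Section Quotients.
Context {R : realType}.

Lemma cvg_quotient (f : R -> R) (x l : R) (h : R^nat) : is_derive x 1 f l ->
  h n @[n --> \oo] --> 0 -> (forall n, h n != 0) ->
  (h n)^-1 * (f (x + h n) - f x) @[n --> \oo] --> l.
Proof.
move=> [fd fl] h0 hn0.
have hd : h n @[n --> \oo] --> 0^'.
  move=> U; rewrite /dnbhs/= /within => /h0 hU.
  suff : \forall n \near \oo, U (h n) by [].
  have : \forall n \near \oo, h n != 0 -> U (h n) := hU.
  by apply: filterS => n; apply.
have := cvg_comp _ _ hd fd; rewrite -[lim _]/('D_1 f x) fl.
apply: cvg_trans; apply: near_eq_cvg; apply: nearW => n /=.
by rewrite /GRing.scale/= mulr1 [x + _]addrC.
Qed.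

(** Multiplying the quotient by the vanishing [h n] recovers continuity along the sequence; the
    expected value after trade obtains its continuity in trust this way. *)
Lemma cvg_of_quotient (f : R -> R) (x l : R) (h : R^nat) :
  (forall n, h n != 0) -> h n @[n --> \oo] --> 0 ->
  (h n)^-1 * (f (x + h n) - f x) @[n --> \oo] --> l ->
  f (x + h n) @[n --> \oo] --> f x.
Proof.
move=> hn0 h0 ql.
have : h n * ((h n)^-1 * (f (x + h n) - f x)) + f x @[n --> \oo] --> 0 * l + f x.
  by apply: cvgD; [exact: cvgM|exact: cvg_cst].
rewrite mul0r add0r; apply: cvg_trans; apply: near_eq_cvg; apply: nearW => n /=.
by rewrite mulrA divff// mul1r subrK.
Qed.

Lemma is_derive_increasing (f df : R -> R) (x y : R) :
  (forall z : R, is_derive z 1 f (df z)) -> (forall z, x < z < y -> 0 < df z) ->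
  x < y -> f x < f y.
Proof.
move=> fd df0 xy; have cf : {within `[x, y], continuous f}.
  by apply: derivable_within_continuous => z _; have [] := fd z.
have [c cxy fxy] := @MVT _ f df _ _ xy (fun z _ => fd z) cf.
by rewrite -subr_gt0 fxy mulr_gt0 ?subr_gt0// df0.
Qed.

(** The sign of [c] selects the side of approach, and its size bounds every step. *)
Definition scaled_harmonic (c : R) (n : nat) : R := c * n.+1%:R^-1.

Lemma scaled_harmonic_cvg c : scaled_harmonic c n @[n --> \oo] --> 0.
Proof.
rewrite -(mulr0 c); apply: cvgMr; exact: cvg_harmonic.
Qed.

Lemma scaled_harmonic_neq0 c n : c != 0 -> scaled_harmonic c n != 0.
Proof. by move=> c0; rewrite mulf_neq0// invr_neq0// pnatr_eq0. Qed.

Lemma scaled_harmonic_gt0 c n : 0 < c -> 0 < scaled_harmonic c n <= c.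
Proof.
move=> c0; rewrite mulr_gt0 ?invr_gt0//= ler_piMr ?(ltW c0)//.
by rewrite invf_le1// ler1n.
Qed.

Lemma scaled_harmonicN c n : scaled_harmonic (- c) n = - scaled_harmonic c n.
Proof. by rewrite /scaled_harmonic mulNr. Qed.

End Quotients.

(** * Chord slopes of concave functions *)

Section Concavity.
Context {R : realType}.

(** [x + h] lies between [x] and the midpoint, and under concavity a shorter chord from [x] has the
    larger slope. *)
Lemma strictly_concave_quotient (A : set R) (f : R -> R) (x y h : R) :
  strictly_concave_on A f -> A x -> A y -> f x <= f y -> x < y ->
  0 < h -> h < (y - x) / 2 -> A ((x + y) / 2) ->
  (f ((x + y) / 2) - f x) / ((y - x) / 2) <= h^-1 * (f (x + h) - f x).
Proof.
move=> cf Ax Ay fxy xy h0 hd Am.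
set m := (x + y) / 2 in Am *; set d := (y - x) / 2 in hd *.
have d0 : 0 < d by rewrite divr_gt0// subr_gt0.
have mE : m = x + d by rewrite /m /d; field.
pose t := 1 - h / d.
have t01 : 0 < t < 1.
  rewrite /t subr_gt0 ltr_pdivrMr// mul1r hd/= gtrDl oppr_lt0.
  by rewrite divr_gt0.
have xm : x != m by rewrite mE lt_eqF// ltrDl.
have := cf x m t Ax Am xm t01.
rewrite (_ : t * x + (1 - t) * m = x + h); last first.
  by rewrite /t mE; field; rewrite gt_eqF.
move=> hc; rewrite [leRHS]mulrC ler_pdivrMr// mulrAC ler_pdivlMr//.
have -> : (f m - f x) * h = (1 - t) * (f m - f x) * d.
  by rewrite /t; field; rewrite gt_eqF.
rewrite ler_pM2r//; lra.
Qed.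

Lemma strictly_concave_midpoint (A : set R) (f : R -> R) (x y : R) :
  strictly_concave_on A f -> A x -> A y -> f x <= f y -> x < y ->
  f x < f ((x + y) / 2).
Proof.
move=> cf Ax Ay fxy xy.
have h01 : 0 < (2^-1 : R) < 1 by rewrite invr_gt0 ltr0n/= invf_lt1// ltr1n.
have := cf x y _ Ax Ay (negbT (lt_eqF xy)) h01.
rewrite (_ : 2^-1 * x + _ = (x + y) / 2); last by field.
lra.
Qed.

(** By concavity the slope of the chord from [0] to [c] is at most the slope over any shorter step,
    hence at most the right derivative. *)
Lemma argmax_of_right_derivative (f : R -> R) (b l : R) : 0 <= b ->
  has_right_derivative f 0 l -> l <= 0 ->
  concave_on [set a | 0 <= a <= b] f ->
  argmax_on [set a | 0 <= a <= b] f 0.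
Proof.
move=> b0 fl l0 conc; split=> [|c /= /andP[c0 cb]]; first by rewrite /= lexx.
have [->//|cn0] := eqVneq c 0.
have {cn0}c0 : 0 < c by rewrite lt_neqAle eq_sym cn0.
suff : (f c - f 0) / c <= l.
  by rewrite ler_pdivrMr// => h; have : l * c <= 0; [rewrite mulr_le0_ge0// ltW|lra].
apply: (cvgr_to_ge fl); near=> h.
have h0 : 0 < h by [].
have hc : h < c by near: h; exact: nbhs_right_lt.
have t1 : h / c <= 1 by rewrite ler_pdivrMr// mul1r ltW.
have t0 : 0 <= h / c by rewrite divr_ge0// ltW.
have := conc (Itv01 t0 t1) c 0.
rewrite !inE /= lexx cb b0 (ltW c0) => /(_ erefl erefl).
have -> : conv (Itv01 t0 t1) (c : convex_lmodType R^o) 0 = 0 + h.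
  rewrite -[LHS]/(h / c * c + (1 - h / c) * 0).
  by rewrite mulr0 addr0 add0r divfK ?gt_eqF.
rewrite -[X in _ <= X -> _]/(h / c * - f c + (1 - h / c) * - f 0).
move=> hh; rewrite [leRHS]mulrC ler_pdivrMr// mulrAC ler_pdivlMr//.
have -> : (f c - f 0) * h = h / c * (f c - f 0) * c.
  by field; rewrite gt_eqF.
rewrite ler_pM2r//; lra.
Unshelve. all: by end_near. Qed.

End Concavity.

(** * Single-peaked profit and the marginal value of extraction *)

Section Margins.
Context {R : realType} (p : primitives R).
Local Notation state := (@state R).
Local Notation states := (states p).
Local Notation actions := (actions p).
Implicit Types (V : state -> R) (s : state).

Lemma is_derive_kfun (a r tau : R) :
  is_derive a 1 (fun b => kfun p b r tau) (- (omega p tau)^-1).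
Proof.
rewrite /kfun /hfun.
by apply: is_derive_eq; rewrite /GRing.scale/=; ring.
Qed.

Lemma is_derive_trade_prob (a r tau : R) :
  is_derive a 1 (fun b => trade_prob p b r tau)
    (- (npdf (kfun p a r tau) / omega p tau)).
Proof.
rewrite -mulrN.
exact: is_derive1_comp (is_derive_ncdf _) (is_derive_kfun a r tau).
Qed.

Lemma trade_prob_aE (a r tau : R) :
  trade_prob_a p a r tau = - (npdf (kfun p a r tau) / omega p tau).
Proof.
by rewrite /trade_prob_a derive1E; have [_ ->] := is_derive_trade_prob a r tau.
Qed.

Lemma trade_prob_a_le0 s a : states s -> trade_prob_a p a s.1.2 s.2 <= 0.
Proof.
move=> ss; rewrite trade_prob_aE oppr_le0 divr_ge0// ltW ?npdf_gt0//.
by apply: omega_gt0; exact: states_tau_gt0 ss.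
Qed.

Lemma marginal_continuation_le0 V s a : states s ->
  restraint_condition p V s a -> marginal_continuation p V s a <= 0.
Proof.
case: s => [[M r] tau] ss [_ dV Er Vr]; have Da := trade_prob_a_le0 a ss.
have b0 := beta_gt0 p; have g0 := gamma_gt0 p.
have /andP[D0 D1] := trade_prob01 p a r tau.
rewrite /= in Da *; set E := EVr_trade _ _ _ _ _ in Er *.
set Z := Vr_notrade _ _ _ _ in Vr *; set D := trade_prob _ _ _ _ in D0 D1 *.
have h1 : beta p * trade_prob_a p a r tau * DeltaV p V M (next_r p r a) tau <= 0.
  by rewrite -mulrA mulr_ge0_le0 ?(ltW b0)// mulr_le0_ge0.
have h2 : D * E <= 0 by rewrite mulr_ge0_le0.
have h3 : (1 - D) * Z <= 0 by rewrite mulr_ge0_le0 ?subr_ge0.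
have h4 : beta p * gamma p * (D * E + (1 - D) * Z) <= 0.
  by rewrite mulr_ge0_le0 ?mulr_ge0 ?(ltW b0) ?(ltW g0)//; lra.
lra.
Qed.

(* The myopic derivative [D + (M + a) D_a - k npdf(k) / 2] with [npdf k] factored out: after
   substituting [a] in terms of [k], the bracket is increasing in [k]. *)
Definition profit_a (M a r tau : R) : R :=
  npdf (kfun p a r tau) *
  (ncdf (kfun p a r tau) / npdf (kfun p a r tau) + kfun p a r tau / 2
   - (M + ell p - ulow p - chi p * r) / omega p tau).

Lemma is_derive_profit (M a r tau : R) : 0 < tau ->
  is_derive a 1 (fun b => profit p M b r tau) (profit_a M a r tau).
Proof.
move=> t0; have o0 := omega_gt0 p t0.
have dD := is_derive_trade_prob a r tau.
have dn : is_derive a 1 (fun b => npdf (kfun p b r tau))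
    (- (kfun p a r tau * npdf (kfun p a r tau)) * - (omega p tau)^-1).
  exact: is_derive1_comp (is_derive_npdf _) (is_derive_kfun a r tau).
have dM : is_derive a 1 (fun b : R => M + b) 1.
  by apply: is_derive_eq; ring.
have dn' := is_deriveZ (omega p tau / 2) dn.
apply: (is_derive_eq (is_deriveB (is_deriveM dM dD) dn')).
rewrite /GRing.scale/= /profit_a /trade_prob.
have n0 := npdf_gt0 (kfun p a r tau).
(* Eliminating [a] uses [(M + a) / omega = (M + ell - ulow - chi r) / omega - k], which turns the
   term [- k npdf(k) / 2] into [+ k npdf(k) / 2]. *)
have kE : kfun p a r tau = hfun p a r / omega p tau by [].
move: n0; set n := npdf _; set N := ncdf _; rewrite kE /hfun => n0.
by field; rewrite ?gt_eqF.
Qed.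

(** The derivative is [1/2] plus a term that [mills_bound] shows to be nonnegative. *)
Lemma mills_increasing (x y : R) : x < y ->
  ncdf x / npdf x + x / 2 < ncdf y / npdf y + y / 2.
Proof.
apply: (@is_derive_increasing _ (fun z : R => ncdf z / npdf z + z / 2)
  (fun z => (npdf z + z * ncdf z) / npdf z + 2^-1)); last first.
  move=> z _; apply: ltr_wpDl; last by rewrite invr_gt0.
  by rewrite divr_ge0 ?mills_bound// ltW// npdf_gt0.
move=> z; have n0 : npdf z != 0 by rewrite gt_eqF// npdf_gt0.
have dv := is_deriveV n0 (is_derive_npdf z).
have d2 : is_derive z 1 (fun z : R => z / 2) 2^-1.
  by apply: is_derive_eq; rewrite /GRing.scale/=; ring.
apply: (is_derive_eq (is_deriveD (is_deriveM (is_derive_ncdf z) dv) d2)).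
by rewrite /GRing.scale/=; field.
Qed.

(** [kfun] falls as the action rises, so the bracket in [profit_a], nonnegative at [b], is strictly
    positive at every smaller action, and profit rises strictly up to [b]. *)
Lemma profit_single_peak (M a b r tau : R) : 0 < tau -> a < b ->
  0 <= profit_a M b r tau -> profit p M a r tau < profit p M b r tau.
Proof.
move=> t0 ab pb; have o0 := omega_gt0 p t0.
apply: (@is_derive_increasing _ (fun z => profit p M z r tau)
  (fun z => profit_a M z r tau)) => // [z|z /andP[az zb]].
  exact: is_derive_profit.
rewrite /profit_a mulr_gt0 ?npdf_gt0//.
have {pb} : 0 <= ncdf (kfun p b r tau) / npdf (kfun p b r tau) + kfun p b r tau / 2
   - (M + ell p - ulow p - chi p * r) / omega p tau.
  by move: pb; rewrite /profit_a pmulr_rge0// npdf_gt0.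
have : kfun p b r tau < kfun p z r tau.
  by rewrite /kfun ltr_pM2r ?invr_gt0// /hfun ltrD2r ltrD2l ltrN2.
move=> /mills_increasing; lra.
Qed.

End Margins.

(** * Differentiating the Bellman objective and comparing the two optima *)

Section MarginalObjective.
Context {R : realType} (p : primitives R).
Local Notation state := (@state R).
Local Notation states := (states p).
Local Notation actions := (actions p).
Implicit Types (V : state -> R) (s : state).

(** By uniqueness on the box, every value function inherits the Lipschitz constant of the
    constructed one. *)
Lemma value_function_lipschitz V : value_function p V ->
  exists2 L, 0 <= L & lipschitz_in_trust p L V.
Proof.
move=> vV; have [V0 [L [vV0 L0 hL]]] := value_function_exists p.
exists L => // M r1 r2 tau s1 s2.
by rewrite !(value_function_unique vV vV0) ?inE//; exact: hL.
Qed.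

(** Dominated convergence with the constant [L], which bounds all quotients; they converge for
    almost every shock. *)
Lemma cvg_expectation_quotient V (L M r tau : R) (h : R^nat) :
  CX p V -> 0 <= L -> lipschitz_in_trust p L V ->
  0 <= r <= rbar p -> taulo p <= tau <= tauhi p ->
  (forall n, 0 <= r + h n <= rbar p) -> (forall n, h n != 0) ->
  h n @[n --> \oo] --> 0 ->
  {ae normal_prob 0 (eta_sd p tau), forall eta,
    derivable (fun x => V (next_M p M eta, x, next_tau p tau)) r 1} ->
  (h n)^-1 * (Eeta p tau (fun eta => V (next_M p M eta, r + h n, next_tau p tau))
    - Eeta p tau (fun eta => V (next_M p M eta, r, next_tau p tau)))
    @[n --> \oo] --> EVr_trade p V M r tau.
Proof.
move=> cV L0 hL hr ht hrn hn0 h0 ae_d.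
pose q n (eta : R) := (h n)^-1 * (V (next_M p M eta, r + h n, next_tau p tau)
  - V (next_M p M eta, r, next_tau p tau)).
have [B VB] := CX_bounded cV.
have m1 n := measurable_next M cV (hrn n) ht.
have m0 := measurable_next M cV hr ht.
have b1 n eta := VB _ (states_trade M eta (hrn n) ht).
have b0 eta := VB _ (states_trade M eta hr ht).
have qE n : Eeta p tau (q n) = (h n)^-1 *
    (Eeta p tau (fun eta => V (next_M p M eta, r + h n, next_tau p tau))
    - Eeta p tau (fun eta => V (next_M p M eta, r, next_tau p tau))).
  rewrite /Eeta -(fine_expectationB _ (m1 n) m0 (b1 n) b0).
  apply: (@fine_expectationZ _ _ _ _ (B + B)); first exact: measurable_funB.
  by move=> eta; rewrite (le_trans (ler_normB _ _))// lerD.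
under eq_fun do rewrite -qE.
apply: (@fine_expectation_cvg _ _ q (fun eta => dr V (next_M p M eta) r (next_tau p tau)) L).
- by move=> n; apply: measurable_funM => //; exact: measurable_funB.
- move=> n eta; rewrite /q normrM normfV mulrC ler_pdivrMr ?normr_gt0//.
  have := hL _ _ _ _ (states_trade M eta (hrn n) ht) (states_trade M eta hr ht).
  by rewrite [r + _]addrC addrK.
- have aeF := ae_filter_ringOfSetsType (normal_prob 0 (eta_sd p tau)).
  apply: (filterS _ ae_d) => eta deta.
  have dV : is_derive r 1 (fun x => V (next_M p M eta, x, next_tau p tau))
      (dr V (next_M p M eta) r (next_tau p tau)).
    by split; [exact: deta|rewrite /dr derive1E].
  exact: (cvg_quotient dV h0 hn0).
Qed.

(* The Lipschitz bound on [V] dominates the difference quotients under the expectation,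
   so the objective may be differentiated along any sequence of feasible actions. *)
Lemma cvg_objective_quotient V s a (h : R^nat) : value_function p V -> states s ->
  actions a -> differentiability_point p V s a ->
  (forall n, h n != 0) -> h n @[n --> \oo] --> 0 ->
  (forall n, actions (a + h n)) ->
  (forall n, rho p * s.1.2 + gamma p * (a + h n) <= rbar p) ->
  (h n)^-1 * (objective p V s (a + h n) - objective p V s a) @[n --> \oo] -->
    profit_a p s.1.1 a s.1.2 s.2 + marginal_continuation p V s a.
Proof.
case: s => [[M r] tau] vV ss aa [/andP[c0 c1] dZ dE] hn0 h0 ahn cap.
have [L L0 hL] := value_function_lipschitz vV; have [cV _] := vV.
have [/= hM hr ht] := ss; have /andP[a0 _] := aa.
have t0 := states_tau_gt0 ss; rewrite /= in t0 cap.
have g0 := gamma_gt0 p.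
set x0 := next_r p r a in dZ dE.
have x0E : x0 = rho p * r + gamma p * a by rewrite /x0 /next_r (min_idPr (ltW c1)).
pose k n := gamma p * h n.
have xnE n : next_r p r (a + h n) = x0 + k n.
  by rewrite x0E /next_r (min_idPr (cap n)) mulrDr addrA.
have hx0 : 0 <= x0 <= rbar p by rewrite x0E !ltW.
have hxn n : 0 <= x0 + k n <= rbar p.
  by rewrite -xnE; apply: states_next_r; [case/andP: hr|case/andP: (ahn n)].
have kn0 n : k n != 0 by rewrite mulf_neq0// gt_eqF.
have k0 : k n @[n --> \oo] --> 0 by rewrite -(mulr0 (gamma p)); exact: cvgMr.
pose E x := Eeta p tau (fun eta => V (next_M p M eta, x, next_tau p tau)).
pose Z x := V (M, x, tau).
have qE : (k n)^-1 * (E (x0 + k n) - E x0) @[n --> \oo] --> EVr_trade p V M x0 tau.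
  exact: (cvg_expectation_quotient cV L0 hL hx0 ht hxn kn0 k0 dE).
have qZ : (k n)^-1 * (Z (x0 + k n) - Z x0) @[n --> \oo] --> Vr_notrade V M x0 tau.
  apply: cvg_quotient => //.
  by rewrite /Vr_notrade /dr derive1E.
have cE := cvg_of_quotient kn0 k0 qE.
have cZ := cvg_of_quotient kn0 k0 qZ.
have qP := cvg_quotient (is_derive_profit p M a r t0) h0 hn0.
have qD := cvg_quotient (is_derive_trade_prob p a r tau) h0 hn0.
pose D b := trade_prob p b r tau.
(* Discrete product rule: the quotient of the trade probability multiplies the value gap at the
   shifted trust state, and [gamma] converts the trust increment [k n] to the action increment
   [h n]. *)
have lim : (h n)^-1 * (profit p M (a + h n) r tau - profit p M a r tau)
    + beta p * ((h n)^-1 * (D (a + h n) - D a) * (E (x0 + k n) - Z (x0 + k n))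
      + (gamma p * D a * ((k n)^-1 * (E (x0 + k n) - E x0))
         + gamma p * (1 - D a) * ((k n)^-1 * (Z (x0 + k n) - Z x0)))) @[n --> \oo] -->
  profit_a p M a r tau + beta p *
    (- (npdf (kfun p a r tau) / omega p tau) * (E x0 - Z x0)
      + (gamma p * D a * EVr_trade p V M x0 tau
         + gamma p * (1 - D a) * Vr_notrade V M x0 tau)).
  apply: cvgD => //; apply: cvgMr; apply: cvgD.
    by apply: cvgM => //; exact: cvgB.
  by apply: cvgD; exact: cvgMr.
have limE : profit_a p M a r tau + marginal_continuation p V (M, r, tau) a =
  profit_a p M a r tau + beta p *
    (- (npdf (kfun p a r tau) / omega p tau) * (E x0 - Z x0)
      + (gamma p * D a * EVr_trade p V M x0 tau
         + gamma p * (1 - D a) * Vr_notrade V M x0 tau)).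
  rewrite /marginal_continuation /DeltaV -/x0 -/(E x0) -/(Z x0) trade_prob_aE -/(D a).
  by ring.
rewrite -limE in lim.
apply: cvg_trans lim; apply: near_eq_cvg; apply: nearW => n.
rewrite /objective /continuation xnE -/x0 -/(D a) -/(D (a + h n)).
rewrite -/(E x0) -/(E (x0 + k n)) -/(Z x0) -/(Z (x0 + k n)).
set E1 := E (x0 + k n); set Z1 := Z (x0 + k n); rewrite /k.
by field; rewrite hn0 gt_eqF.
Qed.

Lemma dynamic_le_myopic V s adyn amyo : value_function p V -> states s ->
  policy p V s adyn -> myopic_policy p s amyo ->
  restraint_condition p V s adyn \/ restraint_condition p V s amyo ->
  strictly_concave_on actions (objective p V s) -> adyn <= amyo.
Proof.
case: s => [[M r] tau] vV ss [ad dmax] [am mmax] cond conc.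
rewrite leNgt; apply/negP => ltda.
have /andP[am0 amb] := am; have /andP[ad0 adb] := ad.
have t0 := states_tau_gt0 ss; rewrite /= in t0.
pose d := (adyn - amyo) / 2.
have d0 : 0 < d by rewrite divr_gt0// subr_gt0.
have dE : amyo + d + d = adyn by rewrite /d; field.
have g0 := gamma_gt0 p.
case: cond => cond; have mc := marginal_continuation_le0 ss cond.
(* Sign conditions at the dynamic optimum: for steps to its left the quotients are nonnegative by
   optimality, which forces marginal profit there to be nonnegative. *)
- have diff : differentiability_point p V (M, r, tau) adyn by have [] := cond.
  have h0 := scaled_harmonic_cvg (- d).
  have hn0 n : scaled_harmonic (- d) n != 0 by rewrite scaled_harmonic_neq0// oppr_eq0 gt_eqF.
  have hle n : 0 < - scaled_harmonic (- d) n <= d.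
    by rewrite scaled_harmonicN opprK scaled_harmonic_gt0.
  have act n : actions (adyn + scaled_harmonic (- d) n).
    by have /andP[] := hle n; rewrite /actions/=; lra.
  have [/andP[_ cap] _ _] := diff.
  have capn n : rho p * r + gamma p * (adyn + scaled_harmonic (- d) n) <= rbar p.
    apply: le_trans (ltW cap); rewrite lerD2l ler_pM2l// gerDl.
    by have /andP[] := hle n; lra.
  have q := cvg_objective_quotient vV ss ad diff hn0 h0 act capn.
  have : 0 <= profit_a p M adyn r tau + marginal_continuation p V (M, r, tau) adyn.
    apply: (cvgr_to_ge q); apply: nearW => n.
    rewrite nmulr_rge0 ?invr_lt0; last by have /andP[] := hle n; lra.
    by rewrite subr_le0; exact: dmax.
  move=> h; have pa : 0 <= profit_a p M adyn r tau by lra.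
  have := profit_single_peak t0 ltda pa.
  by rewrite ltNge (mmax _ ad).
- have diff : differentiability_point p V (M, r, tau) amyo by have [] := cond.
  have [/andP[_ cap] _ _] := diff.
  (* [c] keeps the steps to the right of [amyo] short of the midpoint, hence feasible, and keeps the
     next trust state uncapped. *)
  pose c := Num.min (d / 2) ((rbar p - (rho p * r + gamma p * amyo)) / gamma p).
  have c0 : 0 < c by rewrite lt_min !divr_gt0// subr_gt0.
  have cd : c < d.
    apply: (@le_lt_trans _ _ (d / 2)); last by lra.
    by rewrite ge_min lexx.
  have cg : gamma p * c <= rbar p - (rho p * r + gamma p * amyo).
    by rewrite mulrC -ler_pdivlMr// ge_min lexx orbT.
  have h0 := scaled_harmonic_cvg c.
  have hn0 n : scaled_harmonic c n != 0 by rewrite scaled_harmonic_neq0// gt_eqF.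
  have hle n : 0 < scaled_harmonic c n <= c by exact: scaled_harmonic_gt0.
  have act n : actions (amyo + scaled_harmonic c n).
    by have /andP[] := hle n; rewrite /actions/=; lra.
  have capn n : rho p * r + gamma p * (amyo + scaled_harmonic c n) <= rbar p.
    have : gamma p * scaled_harmonic c n <= gamma p * c by rewrite ler_pM2l//; case/andP: (hle n).
    lra.
  have q := cvg_objective_quotient vV ss am diff hn0 h0 act capn.
  have pa : profit_a p M amyo r tau <= 0.
    apply: (cvgr_to_le (cvg_quotient (is_derive_profit p M amyo r t0) h0 hn0)).
    apply: nearW => n; rewrite pmulr_rle0 ?invr_gt0; last by case/andP: (hle n).
    by rewrite subr_le0; exact: mmax.
  have Am : actions ((amyo + adyn) / 2) by rewrite /actions/=; lra.
  have fle := dmax _ am.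
  have mid := strictly_concave_midpoint conc am ad fle ltda.
  (* The chord to the midpoint has positive slope and bounds all quotients from below, but their
     limit is nonpositive. *)
  have : (objective p V (M, r, tau) ((amyo + adyn) / 2)
      - objective p V (M, r, tau) amyo) / d <=
      profit_a p M amyo r tau + marginal_continuation p V (M, r, tau) amyo.
    apply: (cvgr_to_ge q); apply: nearW => n; have /andP[hn1 hn2] := hle n.
    exact: (strictly_concave_quotient conc am ad fle ltda hn1 (le_lt_trans hn2 cd) Am).
  have : 0 < (objective p V (M, r, tau) ((amyo + adyn) / 2)
      - objective p V (M, r, tau) amyo) / d by rewrite divr_gt0// subr_gt0.
  rewrite /= in mc *; lra.
Qed.

End MarginalObjective.

Theorem proposition2 (R : realType) (p : primitives R) :
  [/\ (* (i) the Bellman operator maps C(X) to itself, with maxima attained *)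
      forall W, CX p W ->
        CX p (bellman p W) /\
        (forall s, states p s -> exists2 a, actions p a & bellman p W s = objective p W s a),
      (* (i) contraction with modulus beta for the sup norm *)
      forall W1 W2, CX p W1 -> CX p W2 ->
        supnorm p (fun s => bellman p W1 s - bellman p W2 s)
          <= beta p * supnorm p (fun s => W1 s - W2 s),
      (* (i) unique bounded continuous fixed point *)
      exists V, value_function p V /\
        (forall V', value_function p V' -> {in states p, V' =1 V}) &
      forall V, value_function p V ->
        [/\ (* (i) nonempty upper-hemicontinuous optimal policy *)
            (forall s, states p s -> policy p V s !=set0) /\
            upper_hemicontinuous (states p) (policy p V),
            (* (ii) *)
            forall s a, states p s -> actions p a -> restraint_condition p V s a ->
              marginal_continuation p V s a <= 0,
            (* (iii) *)
            forall s adyn amyo, states p s ->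
              policy p V s adyn -> myopic_policy p s amyo ->
              restraint_condition p V s adyn \/
                restraint_condition p V s amyo ->
              strictly_concave_on (actions p) (objective p V s) ->
              adyn <= amyo &
            (* (iv) *)
            forall s, states p s ->
              (exists2 l, has_right_derivative (objective p V s) 0 l & l <= 0) ->
              concave_on (actions p) (objective p V s) ->
              policy p V s 0]].
Proof.
split.
- move=> W cW; split; first exact: CX_bellman.
  move=> s ss; have [a amax] := policy_nonempty cW ss.
  by exists a; [case: amax|exact: bellman_policy].
- by move=> W1 W2 c1 c2; exact: supnorm_contraction.
- have [V [L [vV _ _]]] := value_function_exists p.
  by exists V; split=> // V' vV'; exact: value_function_unique.
- move=> V vV; have [cV _] := vV; split.
  + split; last exact: policy_upper_hemicontinuous.
    by move=> s; exact: policy_nonempty.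
  + by move=> s a ss _; exact: marginal_continuation_le0.
  + by move=> s adyn amyo; exact: dynamic_le_myopic.
  + move=> s ss [l fl l0] conc.
    exact: (argmax_of_right_derivative (abar_ge0 p) fl l0 conc).
Qed.
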